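(* Let $n\ge 3$ and let $k_1,\dots,k_n\in\mathbb{Z}_{\ge 0}$. For $I\subset[n]$ write $K(I)=\sum_{i\in I}k_i$. Then the intersection product $\Psi_1^{k_1}\cdot\ldots\cdot\Psi_n^{k_n}$ of tropical Psi-classes on $\mathcal{M}_{0,n}$ is the subfan of $\mathcal{M}_{0,n}$ consisting of the closures of the cones of dimension $n-3-K([n])$ corresponding to abstract $n$-marked rational tropical curves $C$ such that for each vertex $V$ of $C$ we have $\operatorname{val}(V)=K(I_V)+3$, where $$I_V=\{i\in[n] : \text{leaf } i \text{ is adjacent to } V \text{ and } k_i\ge 1\}\subset[n].$$ The weight of the facet $\sigma(C)$ of this fan containing the point $\varphi_n(C)$ equals $$\omega(\sigma(C))=\frac{\prod_{V}K(I_V)!}{\prod_{i=1}^n k_i!},$$ where the product in the numerator runs over all vertices $V$ of $C$.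
   Context: Let $n\ge 3$ be an integer and $[n]=\{1,\dots,n\}$. **Tropical curves and $\mathcal{M}_{0,n}$.** An $n$-marked (rational) abstract tropical curve is a tree without 2-valent vertices, with $n$ leaves (unbounded edges) labeled $1,\dots,n$, together with a positive real length for each bounded (non-leaf) edge. Its combinatorial type is the underlying labeled tree without lengths. Vertices are the inner vertices; the valence $\operatorname{val}(V)$ counts all bounded and unbounded edges at $V$. $\mathcal{M}_{0,n}$ is the set of all such curves; curves of a fixed type with $r$ bounded edges form an open cone $\mathbb{R}_{>0}^r$, and cones are glued so that faces correspond to contracting bounded edges. **Embedding.** Let $\mathcal{T}$ be the set of two-element subsets of $[n]$, $\Phi_n:\mathbb{R}^n\to\mathbb{R}^{\binom n2}$, $a\mapsto(a_i+a_j)_{\{i,j\}\in\mathcal{T}}$, and $Q_n=\mathbb{R}^{\binom n2}/\operatorname{im}(\Phi_n)$. The map $\varphi_n:\mathcal{M}_{0,n}\to Q_n$ sends $C$ to the class of $(\operatorname{dist}(\{i,j\}))_{\{i,j\}}$, where $\operatorname{dist}(\{i,j\})$ is the sum of the lengths of the bounded edges on the path between leaves $i$ and $j$. For $I\subset[n]$ let $v_I\in\mathbb{R}^{\binom n2}$ (and its class in $Q_n$) be given by $(v_I)_T=1$ if $|I\cap T|=1$ and $(v_I)_T=0$ otherwise. For $1<|I|<n-1$, $v_I=v_{[n]\setminus I}$ is the image of the tree with one bounded edge of length one separating the labels in $I$ from those in $[n]\setminus I$. It is known that $\varphi_n$ embeds $\mathcal{M}_{0,n}$ as a pure $(n-3)$-dimensional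 simplicial balanced fan, all facets having weight 1, with respect to the lattice in $Q_n$ generated by the $v_I$. The closed cone of a combinatorial type is generated by the $v_I$ with $I$ running over the splits of $[n]$ given by its bounded edges. If a cone $\tau$ is a codimension-one face of a cone $\sigma$, the primitive vector $u_{\sigma/\tau}$ is $v_I$, where $I$ is the split given by the edge contracted in passing from $\sigma$ to $\tau$. **Divisors.** Let $Z$ be a weighted balanced fan whose cones are closed cones of $\mathcal{M}_{0,n}$ and let $\varphi$ be a continuous function linear on each cone. For a cone $\sigma$ let $\varphi_\sigma$ be the linear function on the span of $\sigma$ that agrees with $\varphi$ on $\sigma$. The divisor of $\varphi$ on $Z$ is the codimension-one skeleton of $Z$ with weights $$\omega(\tau)=\sum_{\sigma\supset\tau}\varphi_\sigma\big(\omega(\sigma)u_{\sigma/\tau}\big)-\varphi_\tau\Big(\sum_{\sigma\supset\tau}\omega(\sigma)u_{\sigma/\tau}\Big),$$ the sums running over the facets $\sigma$ of $Z$ containing $\tau$; cones of weight 0 are discarded. If $Z$ is 0-dimensional or empty, the divisor is the empty (zero) cycle. **Functions $f_k$ and Psi-classes.** For $k\in[n]$ every $v\in Q_n$ has a unique representation $v=\sum_S\lambda_Sv_S$, $S$ running over the two-element subsets of $[n]\setminus\{k\}$, with all $\lambda_S\ge0$ and at least one $\lambda_S=0$. Put $f_k(v)=\sum_S\lambda_S$; this function is linear on every cone of $\mathcal{M}_{0,n}$. The tropical Psi-class $\Psi_k$ is the weighted fan of those closed $(n-4)$-dimensional cones of $\mathcal{M}_{0,n}$ corresponding to curves in which leaf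 $k$ is adjacent to a 4-valent vertex, each with weight 1. The divisor of $f_k$ on $\mathcal{M}_{0,n}$ is $\binom{n-1}{2}\Psi_k$, and accordingly the intersection product with $\Psi_k$ of a weighted balanced fan $Z$ whose cones are closed cones of $\mathcal{M}_{0,n}$ is $\Psi_k\cdot Z=\binom{n-1}{2}^{-1}\cdot(\text{divisor of } f_k \text{ on } Z)$. The product $\Psi_1^{k_1}\cdots\Psi_n^{k_n}$ is obtained from $\mathcal{M}_{0,n}$ by successively multiplying $k_i$ times with $\Psi_i$ for each $i$, in any order; the empty product is $\mathcal{M}_{0,n}$. *)

(* Defs.v *)
From HB Require Import structures.
From mathcomp Require Import all_boot all_order all_algebra.
From mathcomp Require Import boolp classical_sets reals.

Set Implicit Arguments.
Unset Strict Implicit.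
Unset Printing Implicit Defensive.
Import Order.TTheory GRing.Theory Num.Theory.

(* The label set [n] = {1, ..., n} is 'I_n throughout. *)

Section Curves.
Local Open Scope nat_scope.
Variable n : nat.

(* Only the inner vertices are recorded; leaf i is attached to the vertex
   [leaf i]. The 1-valent ends of the leaves are not vertices, so "no 2-valent
   vertices" means that every vertex has valence at least 3. *)
Record ctype := CType {
  vert :> finType;
  adj : rel vert;
  leaf : 'I_n -> vert;
  adj_sym : symmetric adj;
  adj_irr : irreflexive adj;
  adj_connected : forall x y : vert, connect adj x y;
  adj_acyclic : forall c : seq vert, cycle adj c -> uniq c -> size c <= 2;
  adj_stable : forall x : vert,
    3 <= #|[set y | adj x y]| + #|[set i | leaf i == x]|
}.

Definition valence (T : ctype) (x : T) : nat :=
  #|[set y | adj x y]| + #|[set i | leaf T i == x]|.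

(* The labels on the side of x after deleting the bounded edge {x, y}. *)
Definition side (T : ctype) (x y : T) : {set 'I_n} :=
  [set i | connect [rel u v : T | adj u v && ([set u; v] != [set x; y])]
             x (leaf T i)].

(* Each bounded edge contributes both parts I and ~: I of its split. *)
Definition splits (T : ctype) : {set {set 'I_n}} :=
  [set I | [exists x : T, exists y : T, adj x y && (I == side x y)]].

(* A closed cone of M_{0,n} is represented by the set of all I such that v_I
   generates one of its rays. Since v_I = v_(~: I), this set is closed under
   complement and has two elements for each ray. *)
Definition is_cone (s : {set {set 'I_n}}) : bool :=
  `[< exists T : ctype, splits T = s >].

Definition cone := {s : {set {set 'I_n}} | is_cone s}.

Fact is_cone_splits (T : ctype) : is_cone (splits T).
Proof. by apply/asboolP; exists T. Qed.

Definition cone_of (T : ctype) : cone := exist _ (splits T) (is_cone_splits T).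

Definition rays (s : cone) : {set {set 'I_n}} := val s.

Definition cdim (s : cone) : nat := #|rays s|./2.

Definition codim1_face (t s : cone) : bool :=
  (rays t \subset rays s) && (cdim s == (cdim t).+1).

(* k i is the exponent of Psi_i. *)
Definition Ksum (k : 'I_n -> nat) (I : {set 'I_n}) : nat := \sum_(i in I) k i.

Definition Iset (k : 'I_n -> nat) (T : ctype) (x : T) : {set 'I_n} :=
  [set i | (leaf T i == x) && (1 <= k i)].

Definition psi_type (k : 'I_n -> nat) (T : ctype) : Prop :=
  cdim (cone_of T) + Ksum k [set: 'I_n] = n - 3 /\
  forall x : T, valence x = Ksum k (Iset k x) + 3.

End Curves.

Local Open Scope ring_scope.

(* The two-element subset {i, j}, with i < j, is represented by (i, j). *)
Definition pair (n : nat) := {p : 'I_n * 'I_n | (p.1 < p.2)%N}.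

Definition pset (n : nat) (p : pair n) : {set 'I_n} :=
  [set (val p).1; (val p).2].

Section Ambient.
Variables (R : realType) (n : nat).

Definition Vn : Type := {ffun pair n -> R^o}.
HB.instance Definition _ := GRing.Lmodule.on Vn.

Definition Phi (a : 'I_n -> R) : Vn := [ffun p => \sum_(i in pset p) a i].

Definition imPhi : {pred Vn} := fun v => `[< exists a : 'I_n -> R, v = Phi a >].

Lemma imPhiZ (c : R) (v : Vn) : v \in imPhi -> c *: v \in imPhi.
Proof.
move=> /asboolP [a ->]; apply/asboolP; exists (fun i => c * a i).
by apply/ffunP => p; rewrite !ffunE /= scaler_sumr.
Qed.

Fact imPhi_zmod_closed : zmod_closed imPhi.
Proof.
split; first by apply/asboolP; exists (fun=> 0); apply/ffunP => p;
  rewrite !ffunE big1.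
move=> _ _ /asboolP [a ->] /asboolP [b ->]; apply/asboolP.
by exists (fun i => a i - b i); apply/ffunP => p; rewrite !ffunE /= sumrB.
Qed.

HB.instance Definition _ := GRing.isZmodClosed.Build Vn imPhi imPhi_zmod_closed.

Definition Qn : Type := Quotient.quot imPhi.
HB.instance Definition _ := GRing.Zmodule.on Qn.

Definition piQ (v : Vn) : Qn := (\pi_(Quotient.quot imPhi) v)%qT.

Lemma piQ_eq (v w : Vn) : piQ v = piQ w <-> v - w \in imPhi.
Proof.
rewrite Quotient.idealrBE; split; first by move=> h; apply/eqP.
by move/eqP.
Qed.

Lemma piQ_repr (x : Qn) : piQ (repr (x : Quotient.quot imPhi)) = x.
Proof. exact: reprK. Qed.

Lemma piQB (v w : Vn) : piQ (v - w) = piQ v - piQ w.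
Proof. exact: (raddfB (\pi_(Quotient.quot imPhi))%qT). Qed.

Lemma piQD (v w : Vn) : piQ (v + w) = piQ v + piQ w.
Proof. exact: (raddfD (\pi_(Quotient.quot imPhi))%qT). Qed.

Definition scaleQ (c : R) (x : Qn) : Qn :=
  piQ (c *: repr (x : Quotient.quot imPhi)).

Lemma piQZ_subproof (c : R) (v : Vn) : scaleQ c (piQ v) = piQ (c *: v).
Proof.
by apply/piQ_eq; rewrite -scalerBr; apply: imPhiZ; apply/piQ_eq/piQ_repr.
Qed.

Fact scaleQA (a b : R) (x : Qn) : scaleQ a (scaleQ b x) = scaleQ (a * b) x.
Proof. by rewrite -[x]piQ_repr !piQZ_subproof scalerA. Qed.
Fact scaleQ1 : left_id 1 scaleQ.
Proof. by move=> x; rewrite -[x]piQ_repr piQZ_subproof scale1r. Qed.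
Fact scaleQDr : right_distributive scaleQ +%R.
Proof.
move=> c x y; rewrite -[x]piQ_repr -[y]piQ_repr.
by rewrite -piQD !piQZ_subproof scalerDr piQD.
Qed.
Fact scaleQDl (x : Qn) : {morph scaleQ^~ x : a b / a + b}.
Proof. by move=> a b; rewrite -[x]piQ_repr !piQZ_subproof scalerDl piQD. Qed.

HB.instance Definition _ := GRing.Zmodule_isLmodule.Build R Qn
  scaleQA scaleQ1 scaleQDr scaleQDl.

Lemma piQZ (c : R) (v : Vn) : piQ (c *: v) = c *: piQ v.
Proof. by rewrite -piQZ_subproof. Qed.

Definition vI (I : {set 'I_n}) : Qn :=
  piQ [ffun p => (#|I :&: pset p| == 1%N)%:R].

Definition cone_pts (s : cone n) : set Qn :=
  [set v | exists lam : {set 'I_n} -> R,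
     (forall I, 0 <= lam I) /\ v = \sum_(I in rays s) lam I *: vI I]%classic.

End Ambient.

Section MetricCurves.
Variables (R : realType) (n : nat).

(* The value of [len] at non-adjacent vertices is irrelevant. *)
Record curve := Curve {
  ctype_of :> ctype n;
  len : ctype_of -> ctype_of -> R;
  len_sym : forall x y, adj x y -> len x y = len y x;
  len_pos : forall x y, adj x y -> 0 < len x y
}.

(* The path from x to y in the tree, without its first vertex x. *)
Definition tree_path (T : ctype n) (x y : T) : seq T :=
  xget [::] [set p | path (@adj n T) x p /\ last x p = y /\ uniq (x :: p)]%classic.

Definition dist (C : curve) (i j : 'I_n) : R :=
  \sum_(l <- pairmap (@len C) (leaf C i) (tree_path (leaf C i) (leaf C j))) l.

Definition phi_n (C : curve) : Qn R n :=
  piQ [ffun p : pair n => dist C (val p).1 (val p).2].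

End MetricCurves.

Section Divisors.
Variables (R : realType) (n : nat).

(* A weighted fan whose cones are closed cones of M_{0,n} is given by the
   weights of its facets; the cones that are not facets get weight 0. *)
Definition wfan := {ffun cone n -> R}.

Definition M0n : wfan := [ffun s => (cdim s == n - 3)%N%:R].

(* u_{s/t}; by v_I = v_(~: I) the picked part of the split is irrelevant. *)
Definition prim (s t : cone n) : Qn R n :=
  if [pick J in rays s :\: rays t] is Some J then vI R J else 0.

(* The value at v of the linear function phi_s: any linear function on Q_n
   agreeing with phi on s takes this value when v is in the span of s. *)
Definition lin_on (phi : Qn R n -> R) (s : cone n) (v : Qn R n) : R :=
  xget 0 [set c | exists l : {linear Qn R n -> R^o},
            (forall x, cone_pts s x -> l x = phi x) /\ c = l v]%classic.

(* Here t is a facet of the codimension-one skeleton or the sums are empty, in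
   which case the value is 0; thus a 0-dimensional fan has zero divisor. *)
Definition divisor (phi : Qn R n -> R) (Z : wfan) : wfan :=
  [ffun t : cone n =>
     \sum_(s : cone n | (Z s != 0) && codim1_face t s)
        lin_on phi s (Z s *: prim s t)
     - lin_on phi t
         (\sum_(s : cone n | (Z s != 0) && codim1_face t s) Z s *: prim s t)].

Definition pairs_off (k : 'I_n) : {set {set 'I_n}} :=
  [set S : {set 'I_n} | (#|S| == 2%N) && (k \notin S)].

(* The sum of the coefficients of the (unique) nonnegative representation of v
   by the v_S, S in pairs_off k, having a vanishing coefficient. *)
Definition f_ (k : 'I_n) (v : Qn R n) : R :=
  xget 0 [set c | exists lam : {set 'I_n} -> R,
            [/\ forall S, S \in pairs_off k -> 0 <= lam S,
                exists2 S, S \in pairs_off k & lam S = 0,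
                v = \sum_(S in pairs_off k) lam S *: vI R S
              & c = \sum_(S in pairs_off k) lam S]]%classic.

(* Psi_k is 1 / C(n - 1, 2) times the divisor of f_k on M_{0,n}; intersecting
   with Psi_k is defined through the same rational function on Z. *)
Definition psi_mul (k : 'I_n) (Z : wfan) : wfan :=
  [ffun t => ('C(n.-1, 2)%:R)^-1 * divisor (f_ k) Z t].

(* Start with M_{0,n} and multiply by the Psi-classes listed in s, one at a
   time (last letter first); the empty product is M_{0,n}. *)
Definition psi_prod (s : seq 'I_n) : wfan := foldr psi_mul M0n s.

End Divisors.

(* Main.v *)
(* The cones of M_{0,n} are handled as split systems (sets of pairwise nested
   bipartitions of the labels), and the vertices of a tree as the stars of its
   split system: the set partitions of the labels into the branches at a vertex.
   The codimension-one cofaces of a cone t correspond to the ways of distributing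
   the branches of one star P of t over two new vertices A and P \ A.

   The theorem is proved by adding one Psi-class at a time. If the claimed weights
   hold for Z, a coface of t can only have nonzero weight if all the vertices of t
   but one, P, satisfy val = K + 3, and #|P| = K + 4 there. For distinct branches
   a, b of P the weights K(A)! K(P \ A)! of the cofaces that separate a from b add
   up to x_a + x_b, where x_a = (K + 1)! / (w_a + 1) and w_a is k_i if a is the
   leaf i and 0 otherwise; this follows from the cycle lemma. Hence the
   weighted sum of the primitive vectors at t is a combination of the vectors
   x_a v_a: Z is balanced at t, as v_a is a ray of t or vanishes in Q_n. Finally,
   if (p|q)_i is the Gromov product, v equals the sum over {p, q} of
   (p|q)_i v_{p, q} in Q_n, and the divisor of f_i at t is 'C(n-1, 2) times the
   value of (p|q)_i at this weighted sum, for any labels p, q which are in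
   distinct branches at the vertex of the leaf i. Only v_{i} contributes to it,
   so the new weight is x_{i} times the factors of the other vertices. *)

Require Import Defs.
From HB Require Import structures.
From mathcomp Require Import all_boot all_order all_algebra.
From mathcomp Require Import boolp classical_sets reals.
From mathcomp Require Import fintype finset zify ring.
Import Order.TTheory GRing.Theory Num.Theory.
Local Open Scope ring_scope.

Set Implicit Arguments.
Unset Strict Implicit.
Unset Printing Implicit Defensive.

(** * Counting with the cycle lemma *)

Section FirstPassage.
Local Open Scope nat_scope.
Variables (E : finType) (w : E -> nat).
Implicit Types A H : {set E}.

(** The number m (#|A| - 1)! is the share m / #|A| of all orderings of A, for a walk of total drift
    - m. The empty walk is counted once, at m = 0, where this formula would give 0. *)
Definition passage A m : nat :=
  if #|A| == \sum_(x in A) w x + m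
  then (if A == set0 then 1 else m * (#|A|.-1)`!) else 0.

Lemma passage0 A : passage A 0 = (A == set0).
Proof.
rewrite /passage mul0n; case: (eqVneq A) => [->|]; first by rewrite big_set0 cards0.
by case: ifP.
Qed.

(** Recursion on the first step h of the walk, after which a descent by m + w h remains. In closed
    form it says that #|A| m + \sum w = (m + 1)(#|A| - 1) when #|A| = \sum w + m + 1. *)
Lemma passageS A m : passage A m.+1 = \sum_(h in A) passage (A :\ h) (m + w h).
Proof.
rewrite /passage; case: ifP => [cA|/eqP ncA]; last first.
  rewrite big1 // => h hA; case: ifP => // /eqP c'; case: ncA.
  by rewrite [LHS](cardsD1 h) hA (big_setD1 h) //= c' -!addnA; lia.
move/eqP: cA => cAE; case: (eqVneq A) => [A0|nA]; first by move: cAE; rewrite A0 cards0 big_set0.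
have step h : h \in A -> #|A :\ h| = \sum_(x in A :\ h) w x + (m + w h).
  by move=> hA; move: cAE; rewrite (cardsD1 h) hA (big_setD1 h) //=; lia.
(* For a singleton the remaining set is empty, the exceptional case of [passage]; the factorials
   (#|A| - 2)! below require two elements. *)
case c1: (#|A| == 1).
  case/cards1P: c1 => x Ax; rewrite Ax big_set1.
  have := step x; rewrite Ax setDv cards0 big_set0 in_set1 eqxx => /(_ isT) H0.
  rewrite -H0 !eqxx cards1 fact0 muln1; move: cAE.
  by rewrite Ax cards1 big_set1; lia.
have c2 : 1 < #|A| by move: nA; rewrite -card_gt0; lia.
rewrite (eq_bigr (fun h => (m + w h) * (#|A|.-2)`!)); last first.
  move=> h hA; rewrite (step h hA) eqxx -(step h hA).
  have cAh : #|A :\ h| = #|A|.-1 by rewrite (cardsD1 h A) hA.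
  by rewrite -cards_eq0 cAh; case: eqP => [|_] //; lia.
rewrite -big_distrl /= big_split /= sum_nat_const.
have -> : #|A|.-1 = #|A|.-2.+1 by lia.
rewrite factS mulnA; congr (_ * _).
by move: cAE c2; set c := #|A|; set s := \sum_(_ in _) _; nia.
Qed.

Lemma sum_subset_mem (R : nmodType) H h (F : {set E} -> {set E} -> R) : h \in H ->
  (\sum_(A : {set E} | (A \subset H) && (h \in A)) F A (H :\: A) =
   \sum_(A : {set E} | A \subset H :\ h) F (h |: A) (H :\ h :\: A))%R.
Proof.
move=> hH; rewrite (reindex_onto (fun A => h |: A) (fun A => A :\ h)) /=; last first.
  by move=> A /andP [_ hA]; rewrite setD1K.
apply: eq_big => [A|A _]; last first.
  congr (F _ _); apply/setP => x; rewrite !inE negb_or.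
  by case: (x == h); case: (x \in A); case: (x \in H).
rewrite subUset sub1set hH setU11 andbT /= subsetD1.
case AH: (A \subset H) => //=; apply/eqP/idP => [<-|hA].
  by rewrite setD11.
by rewrite setU1K.
Qed.

(* First-passage decomposition: [passage A m] counts the orderings of A for
   which the walk with steps [w x - 1] first reaches [- m] at its last step
   (the cycle lemma); a walk to [- (m + l)] splits at its passage of [- m]. *)
Lemma passage_conv H m l :
  \sum_(A : {set E} | A \subset H) passage A m * passage (H :\: A) l =
  passage H (m + l).
Proof.
have conv0 (K : {set E}) :
    \sum_(A : {set E} | A \subset K) passage A 0 * passage (K :\: A) l = passage K l.
  rewrite (bigD1 set0) ?sub0set //= passage0 eqxx mul1n setD0 big1 ?addn0 //.
  by move=> A /andP [_ /negPf nA]; rewrite passage0 nA.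
move: {2}(#|H|) (leqnn #|H|) => N.
elim: N H m => [|N IH] H [|m] cH; rewrite ?add0n ?conv0 //.
  have H0 : H = set0 by apply/eqP; rewrite -cards_eq0; lia.
  rewrite H0 big1; first by rewrite /passage cards0 big_set0; case: eqP => //; lia.
  by move=> A; rewrite subset0 => /eqP ->; rewrite /passage cards0 big_set0.
(* The first step h of the walk on A is split off. Once the sums are exchanged, h is chosen before A
   and the inner sum is a convolution over H without h. *)
transitivity (\sum_(A : {set E} | A \subset H) \sum_(h | (h \in H) && (h \in A))
    passage (A :\ h) (m + w h) * passage (H :\: A) l).
  apply: eq_bigr => A AH; rewrite passageS big_distrl /=.
  apply: eq_bigl => h; case hA: (h \in A); rewrite ?andbF // andbT.
  by rewrite (subsetP AH).
rewrite (exchange_big_dep (fun h => h \in H)) /=; last by move=> A h _ /andP [].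
rewrite addSn passageS; apply: eq_bigr => h hH.
have cHh : #|H :\ h| <= N by move: cH; rewrite (cardsD1 h) hH; lia.
rewrite addnAC -(IH _ _ cHh).
transitivity (\sum_(A : {set E} | (A \subset H) && (h \in A))
    passage (A :\ h) (m + w h) * passage (H :\: A) l).
  by apply: eq_bigl => A; rewrite hH.
rewrite (@sum_subset_mem nat H h (fun A B => passage (A :\ h) (m + w h) * passage B l)) //.
apply: eq_bigr => A; rewrite subsetD1 => /andP [_ hA].
by rewrite setU1K.
Qed.

Lemma passage_gt0 A m : 0 < m ->
  passage A m = if #|A| == \sum_(x in A) w x + m then m * (#|A|.-1)`! else 0.
Proof.
rewrite /passage; case: ifP => // + m0; case: (eqVneq A) => // ->.
by rewrite cards0 big_set0; lia.
Qed.

(** A new vertex carries the branches in A and the new edge, whose weight is 0, so val = K + 3 there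
    reads #|A| + 1 = K + 3. *)
Definition balanced_part A := #|A| == \sum_(x in A) w x + 2.

(** For a balanced A containing a, (w a + 1) K(A)! is the value of [passage] at A without a and
    depth w a + 1; the same holds for b and the complement. The sum is thus a convolution over H
    without a and b, evaluated by [passage_conv]. *)
Lemma sum_separating H a b : a \in H -> b \in H -> a != b ->
  (\sum_(A : {set E} | [&& A \subset H, a \in A & b \notin A])
     (if balanced_part A && balanced_part (H :\: A)
      then (\sum_(x in A) w x)`! * (\sum_(x in H :\: A) w x)`! else 0))
    * ((w a).+1 * (w b).+1) =
  if #|H| == \sum_(x in H) w x + 4
  then (w a + w b + 2) * (\sum_(x in H) w x).+1`! else 0.
Proof.
move=> aH bH ab; set N := H :\ a :\ b.
have bHa : b \in H :\ a by rewrite !inE eq_sym ab.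
have EN : passage N ((w a).+1 + (w b).+1) =
    if #|H| == \sum_(x in H) w x + 4
    then (w a + w b + 2) * (\sum_(x in H) w x).+1`! else 0.
  rewrite passage_gt0 // (cardsD1 a H) aH (cardsD1 b (H :\ a)) bHa -/N.
  rewrite (big_setD1 a aH) (big_setD1 b bHa) -/N.
  have -> : (#|N| == \sum_(x in N) w x + ((w a).+1 + (w b).+1)) =
    (true + (true + #|N|) == w a + (w b + \sum_(i in N) w i) + 4) by lia.
  case: ifP => // c.
  have -> : (w a).+1 + (w b).+1 = w a + w b + 2 by lia.
  by congr (_ * _`!); move/eqP: c => /=; lia.
rewrite -EN -passage_conv big_distrl /=.
rewrite (eq_bigl (fun A : {set E} => ((A \subset H) && (a \in A)) && (b \notin A))); last first.
  by move=> A; rewrite andbA.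
rewrite big_mkcondr /=.
rewrite (@sum_subset_mem nat H a (fun A B => if b \notin A then
  (if balanced_part A && balanced_part B
      then (\sum_(x in A) w x)`! * (\sum_(x in B) w x)`! else 0)
    * ((w a).+1 * (w b).+1) else 0)) //.
rewrite -big_mkcondr; apply: eq_big => [A|A].
  rewrite !inE (eq_sym b) (negPf ab) /= [RHS]subsetD1; congr (_ && _).
move=> /andP [+]; rewrite !inE (eq_sym b) (negPf ab) /= subsetD1.
move=> /andP [AH aA] bA.
rewrite !passage_gt0 // /balanced_part cardsU1 aA big_setU1 //=.
have bB : b \in H :\ a :\: A by rewrite inE bA bHa.
rewrite (cardsD1 b (H :\ a :\: A)) bB (big_setD1 b bB) /=.
have -> : H :\ a :\: A :\ b = N :\: A.
  by apply/setP => x; rewrite !inE; case: (x == b); case: (x == a); case: (x \in A).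
rewrite (_ : (_ == _ + _ + 2) = (#|A| == \sum_(x in A) w x + (w a).+1)); last by lia.
rewrite (_ : (_ == _ + _ + 2) = (#|N :\: A| == \sum_(x in N :\: A) w x + (w b).+1)); last by lia.
case: eqP => //= cA; case: eqP => //= cB; last by rewrite muln0.
have -> : w a + \sum_(x in A) w x = #|A|.-1 by lia.
have -> : w b + \sum_(x in N :\: A) w x = #|N :\: A|.-1 by lia.
by rewrite -!mulnA; ring.
Qed.

End FirstPassage.

(** * Split systems and their stars *)

Section SplitSystems.
Local Open Scope nat_scope.
Variable L : finType.
Implicit Types (I J B : {set L}) (s P Q A : {set {set L}}).

Definition nested I J :=
  [|| I \subset J, I \subset ~: J, ~: I \subset J | ~: I \subset ~: J].

Definition split_system s :=
  [forall I in s, [&& ~: I \in s, 1 < #|I| & [forall J in s, nested I J]]].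

(* The singletons are the blocks contributed by leaves. *)
Definition branch s I := (I \in s) || (#|I| == 1).

(* The set partitions into the branches at a vertex of the tree with splits s. *)
Definition star s P :=
  [&& partition P setT, 2 < #|P|, [forall B in P, branch s B]
    & [forall J in s, [exists B in P, (J \subset B) || (~: J \subset B)]]].

Definition stars s := [set P | star s P].

Definition add_split s J := J |: (~: J |: s).

Definition new_split s J :=
  [&& J \notin s, 1 < #|J|, 1 < #|~: J| & [forall I in s, nested I J]].

(** Each new vertex gets the new edge as one further branch, so two old branches are what valence 3
    requires. *)
Definition splits_star A P := [&& A \subset P, 1 < #|A| & 1 < #|P :\: A|].

Lemma nestedC I J : nested I J = nested J I.
Proof.
rewrite /nested !setCS (subsetC I) (subCset I J).
by case: (J \subset I); case: (I \subset J); rewrite ?orbT ?orbF //= orbC.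
Qed.

Lemma nestedCl I J : nested (~: I) J = nested I J.
Proof. by rewrite /nested setCK; do !case: (_ \subset _). Qed.

Lemma nestedCr I J : nested I (~: J) = nested I J.
Proof. by rewrite nestedC nestedCl nestedC. Qed.

Lemma split_systemP s :
  reflect [/\ forall I, I \in s -> ~: I \in s, forall I, I \in s -> 1 < #|I|
            & forall I J, I \in s -> J \in s -> nested I J] (split_system s).
Proof.
apply: (iffP forall_inP) => [ss|[s1 s2 s3] I sI].
  split=> [I|I|I J] /ss /and3P [] // _ _ /forall_inP; exact.
by rewrite s1 // s2 //=; apply/forall_inP => J sJ; apply: s3.
Qed.

Lemma starP s P :
  reflect [/\ partition P setT, 2 < #|P|, forall B, B \in P -> branch s B
     & forall J, J \in s -> exists2 B, B \in P & (J \subset B) || (~: J \subset B)]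
    (star s P).
Proof.
apply: (iffP and4P) => [] [p1 p2 p3 p4]; split=> //.
- exact/forall_inP.
- by move=> J /(forall_inP p4) /exists_inP.
- exact/forall_inP.
- by apply/forall_inP => J /p4 /exists_inP.
Qed.

Section Partition.
Variable P : {set {set L}}.
Hypothesis pP : partition P setT.

Lemma part_neq0 B : B \in P -> B != set0.
Proof. by case/and3P: pP => _ _ n0 BP; apply: contraNneq n0 => <-. Qed.

Lemma part_eq B B' x : B \in P -> B' \in P -> x \in B -> x \in B' -> B = B'.
Proof.
case/and3P: pP => _ /trivIsetP tP _ BP B'P xB xB'; apply/eqP.
by apply: contraTT xB' => /(tP _ _ BP B'P) /disjointFr ->.
Qed.

Lemma part_ex x : exists2 B, B \in P & x \in B.
Proof.
case/and3P: pP => /eqP cP _ _; have : x \in cover P by rewrite cP.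
by case/bigcupP => B; exists B.
Qed.

Lemma part_sub B B' : B \in P -> B' \in P -> B \subset B' -> B = B'.
Proof.
move=> BP B'P BB'; have /set0Pn [x xB] := part_neq0 BP.
exact: (part_eq BP B'P xB (subsetP BB' x xB)).
Qed.

Lemma part_disj B B' : B \in P -> B' \in P -> B != B' -> B \subset ~: B'.
Proof.
move=> BP B'P nB; apply/subsetP => x xB; rewrite inE.
by apply: contraNN nB => xB'; apply/eqP/(part_eq BP B'P xB xB').
Qed.

(** Two blocks out of at least three leave some label uncovered. This is how the wrong one of two
    possible inclusions between branches is excluded later on. *)
Lemma part_subC B B' : 2 < #|P| -> B \in P -> B' \in P -> ~: B \subset B' -> False.
Proof.
move=> cP BP B'P sB.
suff : P \subset [set B; B'].
  by move/subset_leq_card; rewrite cards2; case: (B != B'); lia.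
apply/subsetP => C CP; rewrite !inE; have /set0Pn [x xC] := part_neq0 CP.
case xB: (x \in B); first by rewrite (part_eq CP BP xC xB) eqxx.
have xB' : x \in B' by apply: (subsetP sB); rewrite inE xB.
by rewrite (part_eq CP B'P xC xB') eqxx orbT.
Qed.

Lemma coverC A : A \subset P -> cover (P :\: A) = ~: cover A.
Proof.
move=> AP; apply/setP => x; rewrite inE; have [B BP xB] := part_ex x.
apply/bigcupP/idP => [[C]|].
  rewrite inE => /andP [CA CP] xC; apply: contraNN CA => /bigcupP [D DA xD].
  by rewrite (part_eq CP (subsetP AP D DA) xC xD).
move=> xnA; exists B => //; rewrite inE BP andbT; apply: contraNN xnA => BA.
by apply/bigcupP; exists B.
Qed.

Lemma sub_cover B A : B \in A -> B \subset cover A.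
Proof. by move=> BA; apply/subsetP => x xB; apply/bigcupP; exists B. Qed.

Lemma cover_notsub A B : A \subset P -> 1 < #|A| -> B \in P -> ~~ (cover A \subset B).
Proof.
move=> AP cA BP; apply: contraTN cA => sB; rewrite -leqNgt -(cards1 B).
apply/subset_leq_card/subsetP => C CA; rewrite inE; apply/eqP.
by apply: (part_sub (subsetP AP C CA) BP); apply: subset_trans (sub_cover CA) sB.
Qed.

Lemma cover_card A : A \subset P -> cover A != set0 -> cover A \notin P -> 1 < #|A|.
Proof.
move=> AP c0; apply: contraNT; rewrite -leqNgt => cA.
have [A0|/set0Pn [B BA]] := eqVneq A set0.
  by move: c0; rewrite A0 /cover big_set0 eqxx.
have -> : A = [set B].
  by apply/esym/eqP; rewrite eqEcard sub1set BA cards1.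
by rewrite /cover big_set1 (subsetP AP).
Qed.

Lemma mem_part_cover A B : A \subset P -> B \in P -> B \subset cover A -> B \in A.
Proof.
move=> AP BP sB; have /set0Pn [x xB] := part_neq0 BP.
have /bigcupP [C CA xC] := subsetP sB x xB.
by rewrite (part_eq BP (subsetP AP C CA) xB xC).
Qed.

End Partition.

Lemma refine_eq P Q : partition P setT -> partition Q setT ->
  (forall B, B \in P -> exists2 C, C \in Q & B \subset C) ->
  (forall B, B \in Q -> exists2 C, C \in P & B \subset C) -> P = Q.
Proof.
move=> pP pQ PQ QP; apply/eqP; rewrite eqEsubset; apply/andP; split.
  apply/subsetP => B BP; have [C CQ BC] := PQ B BP; have [D DP CD] := QP C CQ.
  have BD := part_sub pP BP DP (subset_trans BC CD).
  suff -> : B = C by []; apply/eqP; rewrite eqEsubset BC; by rewrite BD.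
apply/subsetP => B BQ; have [C CP BC] := QP B BQ; have [D DQ CD] := PQ C CP.
have BD := part_sub pQ BQ DQ (subset_trans BC CD).
suff -> : B = C by []; apply/eqP; rewrite eqEsubset BC; by rewrite BD.
Qed.

Lemma star_branch s P B : star s P -> branch s B ->
  exists2 C, C \in P & (B \subset C) || (~: B \subset C).
Proof.
case/starP => pP _ _ sP /orP [/sP //|/cards1P [x ->]].
by have [C CP xC] := part_ex pP x; exists C => //; rewrite sub1set xC.
Qed.

(** A branch amounts to an edge directed away from its vertex, and so determines the vertex. If
    another block C of P had its complement inside a block D of Q, then B would lie in D, so D = B,
    and the blocks B and C of P would cover everything. *)
Lemma star_mem_inj s P Q B : star s P -> star s Q -> B \in P -> B \in Q -> P = Q.
Proof.
have half P1 P2 C : star s P1 -> star s P2 -> B \in P1 -> B \in P2 -> C \in P1 ->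
    exists2 D, D \in P2 & C \subset D.
  move=> s1 s2 B1 B2 C1; have /starP [p1 c1 b1 _] := s1.
  have [D D2 /orP [CD|CD]] := star_branch s2 (b1 C C1); first by exists D.
  have [CB|nCB] := eqVneq C B; first by exists B; rewrite // CB.
  have /starP [p2 c2 _ _] := s2.
  have BD : B = D.
    apply: (part_sub p2) => //; apply: subset_trans CD.
    by apply: (part_disj p1); rewrite // eq_sym.
  by case: (part_subC p1 c1 C1 B1); rewrite BD.
move=> sP sQ BP BQ; have /starP [pP _ _ _] := sP; have /starP [pQ _ _ _] := sQ.
by apply: (refine_eq pP pQ) => C; [apply: (half P Q)|apply: (half Q P)].
Qed.

Lemma splits_starC s P A : star s P -> splits_star A P ->
  splits_star (P :\: A) P /\ cover (P :\: A) = ~: cover A.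
Proof.
case/starP => pP _ _ _ /and3P [AP A1 A2]; split; last exact: (coverC pP).
by rewrite /splits_star subsetDl A2 setDDr setDv set0U (setIidPr AP).
Qed.

Lemma cover_neq0 s P A : star s P -> splits_star A P -> cover A != set0.
Proof.
case/starP => pP _ _ _ /and3P [AP A1 _].
have /card_gt0P [B BA] : 0 < #|A| by lia.
have /set0Pn [x xB] := part_neq0 pP (subsetP AP B BA).
by apply/set0Pn; exists x; apply: (subsetP (sub_cover BA)).
Qed.

(** A block of P inside the cover lies in a block of Q: otherwise its complement does, and then so
    does the complement of the cover, which consists of at least two blocks of Q. Passing to the
    complements treats the other blocks of P, and by symmetry P and Q refine each other. *)
Lemma splits_star_inj s P Q A A' : star s P -> star s Q ->
  splits_star A P -> splits_star A' Q -> cover A = cover A' -> P = Q /\ A = A'.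
Proof.
have half P1 P2 A1 A2 B : star s P1 -> star s P2 -> splits_star A1 P1 ->
    splits_star A2 P2 -> cover A1 = cover A2 -> B \in A1 ->
    exists2 C, C \in P2 & B \subset C.
  move=> s1 s2 a1 a2 c12 B1.
  have /starP [p1 c1 b1 _] := s1; have /starP [p2 c2 _ _] := s2.
  have /and3P [A1P A1c A1c'] := a1; have /and3P [A2P A2c A2c'] := a2.
  have [C C2 /orP [BC|BC]] := star_branch s2 (b1 B (subsetP A1P B B1)).
    by exists C.
  have [_ cC] := splits_starC s2 a2.
  case/negP: (cover_notsub p2 (subsetDl _ _) A2c' C2).
  rewrite cC -c12; apply: subset_trans BC; rewrite setCS; exact: sub_cover.
have full P1 P2 A1 A2 B : star s P1 -> star s P2 -> splits_star A1 P1 ->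
    splits_star A2 P2 -> cover A1 = cover A2 -> B \in P1 ->
    exists2 C, C \in P2 & B \subset C.
  move=> s1 s2 a1 a2 c12 B1; case BA: (B \in A1).
    exact: (half P1 P2 A1 A2).
  have [a1' c1'] := splits_starC s1 a1; have [a2' c2'] := splits_starC s2 a2.
  apply: (half P1 P2 _ _ _ s1 s2 a1' a2'); first by rewrite c1' c2' c12.
  by rewrite inE BA.
move=> sP sQ aP aQ cPQ; have /starP [pP _ _ _] := sP; have /starP [pQ _ _ _] := sQ.
have PQ : P = Q.
  by apply: (refine_eq pP pQ) => B; [apply: (full P Q A A')|apply: (full Q P A' A)].
split=> //; have /and3P [AP _ _] := aP; have /and3P [AQ _ _] := aQ.
apply/setP => B; apply/idP/idP => BA.
  by apply: (mem_part_cover pQ) => //; rewrite -?PQ ?(subsetP AP) // -cPQ sub_cover.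
by apply: (mem_part_cover pP) => //; rewrite ?PQ ?(subsetP AQ) // cPQ sub_cover.
Qed.

(** * Inserting a new split into a split system *)

Section Refinement.
Variable s : {set {set L}}.
Hypothesis ss : split_system s.

Lemma branch_nested I J : branch s I -> (J \in s) || new_split s J -> nested I J.
Proof.
have [_ _ s3] := split_systemP s ss.
case/orP => [sI|/cards1P [x ->] _]; last first.
  by rewrite /nested !sub1set inE; case: (x \in J).
by case/orP => [sJ|/and4P [_ _ _ /forall_inP sJ]]; [apply: s3|apply: sJ].
Qed.

Lemma branch_nested2 I J : branch s I -> branch s J -> nested I J.
Proof.
move=> bI /orP [sJ|/cards1P [x ->]]; first by apply: branch_nested; rewrite ?sJ.
by rewrite nestedC /nested !sub1set inE; case: (x \in I).
Qed.

Lemma new_splitC J : new_split s J -> new_split s (~: J).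
Proof.
have [s1 _ _] := split_systemP s ss; case/and4P => sJ J1 J2 /forall_inP nJ.
rewrite /new_split setCK J1 J2 /=; apply/andP; split.
  by apply: contraNN sJ => /s1; rewrite setCK.
by apply/forall_inP => I sI; rewrite nestedCr nJ.
Qed.

Lemma split_system_add J : new_split s J -> split_system (add_split s J).
Proof.
have [s1 s2 s3] := split_systemP s ss.
move=> nJ; have /and4P [_ J1 J2 /forall_inP n0] := nJ.
have n1 I : I \in add_split s J -> nested I J.
  rewrite !inE => /or3P [/eqP ->|/eqP ->|/n0 //]; rewrite ?nestedCl;
  by rewrite /nested subxx.
apply/split_systemP; split=> [I|I|I K].
- rewrite !inE => /or3P [/eqP ->|/eqP ->|/s1 ->]; rewrite ?setCK ?eqxx ?orbT //.
- by rewrite !inE => /or3P [/eqP ->|/eqP ->|/s2].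
- move=> sI; rewrite !inE => /or3P [/eqP ->|/eqP ->|sK]; rewrite ?nestedCr ?n1 //.
  move: sI; rewrite !inE => /or3P [/eqP ->|/eqP ->|sI]; last exact: s3;
  by rewrite ?nestedCl nestedC n0.
Qed.

Lemma new_split_star P A : star s P -> splits_star A P -> new_split s (cover A).
Proof.
move=> sP aP; have [aC cC] := splits_starC sP aP.
have /starP [pP cP bP iP] := sP.
have two A1 : splits_star A1 P -> 1 < #|cover A1|.
  move=> a1; have /and3P [A1P A1c _] := a1.
  rewrite ltn_neqAle card_gt0 (cover_neq0 sP a1) andbT eq_sym.
  apply/negP => /cards1P [x cx]; have [B BP xB] := part_ex pP x.
  by have := cover_notsub pP A1P A1c BP; rewrite cx sub1set xB.
have /and3P [AP A1 A2] := aP.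
rewrite /new_split -cC !two //=; apply/andP; split.
  apply/negP => /iP [B BP]; rewrite (negPf (cover_notsub pP AP A1 BP)) -cC /=.
  by rewrite (negPf (cover_notsub pP (subsetDl _ _) A2 BP)).
apply/forall_inP => I /iP [B BP].
have : (B \subset cover A) || (B \subset ~: cover A).
  case BA: (B \in A); first by rewrite sub_cover.
  by rewrite -cC (@sub_cover B (P :\: A)) ?orbT // inE BA.
by case/orP => sB /orP [] IB; rewrite /nested (subset_trans IB sB) ?orbT.
Qed.

(** The vertex at which J is inserted has as branches the maximal branches of [s] contained in J or
    in its complement. They cover all labels because singletons are branches. *)
Lemma new_split_ex J : new_split s J ->
  exists P A, [/\ star s P, splits_star A P & cover A = J].
Proof.
move=> nJ; have /and4P [sJ J1 J2 /forall_inP n0] := nJ.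
have [s1 s2 s3] := split_systemP s ss.
pose p I := branch s I && ((I \subset J) || (I \subset ~: J)).
pose P : {set {set L}} := [set I | maxset p I].
have P_p B : B \in P -> p B by rewrite inE => /maxsetp.
have P_max B C : B \in P -> p C -> B \subset C -> C = B.
  by rewrite inE => /maxsetsup h pC BC; apply: h.
have P_ex B : p B -> exists2 C : {set L}, C \in P & B \subset C.
  by case/maxset_exists => C mC BC; exists C => //; rewrite inE.
have xP x : exists2 B : {set L}, B \in P & x \in B.
  have [|B BP] := P_ex [set x]; last by rewrite sub1set; exists B.
  by rewrite /p /branch cards1 eqxx orbT !sub1set inE; case: (x \in J).
have PJ B : B \in P -> (B \subset J) || (B \subset ~: J) by move/P_p/andP => [].
have n0J : J != set0 by rewrite -card_gt0; lia.
have n0J' : ~: J != set0 by rewrite -card_gt0; lia.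
have uniqP (B C : {set L}) x : B \in P -> C \in P -> x \in B -> x \in C -> B = C.
  move=> BP CP xB xC.
  have /orP [BC|/or3P [BC|BC|BC]] :=
    branch_nested2 (proj1 (andP (P_p B BP))) (proj1 (andP (P_p C CP))).
  - by rewrite (P_max B C BP (P_p C CP)).
  - by have := subsetP BC x xB; rewrite inE xC.
  (* Here B and C cover all labels. On the same side of J they would make the other side empty; on
     different sides they could not share x. *)
  - have cov (K : {set L}) : B \subset K -> C \subset K -> ~: K = set0.
      move=> BK CK; apply/setP => y; rewrite !inE; apply/negbTE; rewrite negbK.
      case yB: (y \in B); first exact: (subsetP BK).
      by apply: (subsetP CK); apply: (subsetP BC); rewrite inE yB.
    case/orP: (PJ B BP) => BJ; case/orP: (PJ C CP) => CJ.
    + by case/eqP: n0J'; apply: cov.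
    + by have := subsetP BJ x xB; have := subsetP CJ x xC; rewrite inE => /negPf ->.
    + by have := subsetP CJ x xC; have := subsetP BJ x xB; rewrite inE => /negPf ->.
    + by case/eqP: n0J; rewrite -[J]setCK; apply: cov.
  - by rewrite setCS in BC; rewrite (P_max C B CP (P_p B BP)).
have pP : partition P setT.
  apply/and3P; split.
  - by apply/eqP/setP => x; rewrite inE; have [B BP xB] := xP x; apply/bigcupP; exists B.
  - apply/trivIsetP => B C BP CP; apply: contraR; rewrite -setI_eq0 => /set0Pn [x].
    by rewrite inE => /andP [xB xC]; apply/eqP/(uniqP B C x).
  - apply/negP => /P_p /andP [] /orP [/s2|]; rewrite cards0 //.
pose A : {set {set L}} := [set B in P | B \subset J].
have AP : A \subset P by apply/subsetP => B; rewrite inE => /andP [].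
have cA : cover A = J.
  apply/setP => x; apply/bigcupP/idP => [[B]|xJ].
    by rewrite inE => /andP [_ /subsetP]; apply.
  have [B BP xB] := xP x; exists B => //; rewrite inE BP /=.
  case/orP: (PJ B BP) => // /subsetP /(_ x xB); by rewrite inE xJ.
have cA' : cover (P :\: A) = ~: J by rewrite (coverC pP) // cA.
(* A single block would make J itself a branch, but J is neither in [s] nor a singleton. *)
have A1 : 1 < #|A|.
  apply: (cover_card AP); rewrite cA //; apply/negP => /P_p /andP [+ _].
  by rewrite /branch (negPf sJ) => /eqP; lia.
have A2 : 1 < #|P :\: A|.
  apply: (cover_card (subsetDl _ _)); rewrite cA' //; apply/negP => /P_p /andP [+ _].
  by have /and4P [sJ' _ _ _] := new_splitC nJ; rewrite /branch (negPf sJ') => /eqP; lia.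
exists P, A; split=> //; last by apply/and3P.
apply/starP; split=> // [|B /P_p /andP [] //|I sI].
  by move: A2; rewrite cardsD (setIidPr AP); lia.
have pI K : K \in s -> (K \subset J) || (K \subset ~: J) -> exists2 C, C \in P & K \subset C.
  by move=> sK KJ; apply: P_ex; rewrite /p /branch sK.
have /orP [IJ|/or3P [IJ|IJ|IJ]] := n0 I sI.
- by have [|C CP IC] := pI I sI; [rewrite IJ|exists C; rewrite ?IC].
- by have [|C CP IC] := pI I sI; [rewrite IJ orbT|exists C; rewrite ?IC].
- by have [|C CP IC] := pI _ (s1 I sI); [rewrite IJ|exists C; rewrite ?IC ?orbT].
- by have [|C CP IC] := pI _ (s1 I sI); [rewrite IJ orbT|exists C; rewrite ?IC ?orbT].
Qed.

Lemma star_add_block P A : star s P -> splits_star A P ->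
  star (add_split s (cover A)) (~: cover A |: A).
Proof.
move=> sP aP; have nJ := new_split_star sP aP; have /and4P [sJ J1 J2 _] := nJ.
have /starP [pP cP bP iP] := sP; have /and3P [AP A1 A2] := aP.
set J := cover A in nJ sJ J1 J2 *.
have JA : ~: J \notin A.
  apply/negP => /sub_cover /subsetP JJ; have /card_gt0P [x] : 0 < #|~: J| by lia.
  by move=> xJ; have := JJ x xJ; move: xJ; rewrite inE => /negPf ->.
apply/starP; split.
- apply/and3P; split.
  + by rewrite /cover big_setU1 //= -/(cover A) -/J setUC setUCr eqxx.
  + apply/trivIsetP => B C; rewrite !inE => /orP [/eqP ->|BA] /orP [/eqP ->|CA].
    * by rewrite eqxx.
    * by move=> _; rewrite -setI_eq0 setIC -subset0 -(setICr J) setSI // sub_cover.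
    * by move=> _; rewrite -setI_eq0 -subset0 -(setICr J) setSI // sub_cover.
    * by case/and3P: pP => _ /trivIsetP h _; apply: h; apply: (subsetP AP).
  + rewrite !inE negb_or; apply/andP; split.
      by rewrite eq_sym -card_gt0; lia.
    by apply/negP => /(subsetP AP) /(part_neq0 pP); rewrite eqxx.
- by rewrite cardsU1 JA; lia.
- move=> B; rewrite !inE /branch => /orP [/eqP ->|BA]; first by rewrite !inE eqxx orbT.
  by have /orP [sB|->] := bP B (subsetP AP B BA); rewrite ?orbT // !inE sB !orbT.
- move=> I; rewrite !inE => /or3P [/eqP ->|/eqP ->|/iP [B BP IB]].
  + by exists (~: J); rewrite ?inE ?eqxx ?subxx ?orbT.
  + by exists (~: J); rewrite ?inE ?eqxx ?subxx.
  + case BA: (B \in A); first by exists B; rewrite // inE BA orbT.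
    have BJ : B \subset ~: J by rewrite -(coverC pP) // sub_cover // inE BA.
    exists (~: J); first by rewrite !inE eqxx.
    by case/orP: IB => IB; rewrite (subset_trans IB BJ) ?orbT.
Qed.

Lemma add_splitC J : add_split s (~: J) = add_split s J.
Proof. by rewrite /add_split setCK setUCA. Qed.

Lemma star_add_blockC P A : star s P -> splits_star A P ->
  star (add_split s (cover A)) (cover A |: (P :\: A)).
Proof.
move=> sP aP; have [aC cC] := splits_starC sP aP.
by have := star_add_block sP aC; rewrite cC setCK add_splitC.
Qed.

(** If no block of Q contained J or its complement, each block would lie on one side of J, so J
    would also split the star Q, and [splits_star_inj] would give Q = P. *)
Lemma star_add_old P A Q : star s P -> splits_star A P ->
  star s Q -> Q != P -> star (add_split s (cover A)) Q.
Proof.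
move=> sP aP sQ nQP; have nJ := new_split_star sP aP.
have /and4P [sJ J1 J2 _] := nJ.
set J := cover A in nJ sJ J1 J2 *; have /starP [pQ cQ bQ iQ] := sQ.
have [B BQ JB] : exists2 B, B \in Q & (J \subset B) || (~: J \subset B).
  apply/exists_inP; apply: contraNT nQP => /exists_inPn noB.
  pose A' : {set {set L}} := [set B in Q | B \subset J].
  have BJ B : B \in Q -> (B \subset J) || (B \subset ~: J).
    move=> BQ; have := noB B BQ; have := branch_nested (bQ B BQ).
    move=> /(_ J); rewrite nJ orbT => /(_ isT); rewrite /nested (subCset B) setCS.
    by case: (J \subset B); case: (~: J \subset B); rewrite ?orbF ?orbT.
  have A'Q : A' \subset Q by apply/subsetP => B; rewrite inE => /andP [].
  have cA' : cover A' = J.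
    apply/setP => x; apply/bigcupP/idP => [[B]|xJ].
      by rewrite inE => /andP [_ /subsetP]; apply.
    have [B BQ xB] := part_ex pQ x; exists B => //; rewrite inE BQ /=.
    case/orP: (BJ B BQ) => // /subsetP /(_ x xB); by rewrite inE xJ.
  have aQ : splits_star A' Q.
    apply/and3P; split=> //.
      apply: (cover_card A'Q); rewrite cA'; first by rewrite -card_gt0; lia.
      by apply/negP => JQ; have := noB _ JQ; rewrite subxx.
    apply: (cover_card (subsetDl _ _)); rewrite (coverC pQ) // cA'.
      by rewrite -card_gt0; lia.
    by apply/negP => JQ; have := noB _ JQ; rewrite subxx orbT.
  by have [-> _] := splits_star_inj sQ sP aQ aP cA'.
apply/starP; split=> //.
  by move=> C /bQ /orP [sC|]; rewrite /branch !inE ?sC ?orbT // => ->; rewrite orbT.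
move=> I; rewrite !inE => /or3P [/eqP ->|/eqP ->|/iQ //].
- by exists B.
- by exists B; rewrite // setCK orbC.
Qed.

(** A star of the refined system that has the new split or its complement as a block is one of the
    two new stars by [star_mem_inj]. Any other one has only old branches and hence is a star of
    [s]. *)
Lemma stars_add P A : star s P -> splits_star A P ->
  stars (add_split s (cover A)) =
  (~: cover A |: A) |: ((cover A |: (P :\: A)) |: (stars s :\ P)).
Proof.
move=> sP aP; have nJ := new_split_star sP aP.
have /starP [pP cP bP iP] := sP; have /and3P [AP A1 A2] := aP.
have [_ cC] := splits_starC sP aP.
apply/setP => Q; rewrite !inE; apply/idP/or3P; last first.
  case=> [/eqP ->|/eqP ->|/andP [nQ sQ]].
  - exact: (star_add_block sP).
  - exact: (star_add_blockC sP).
  - exact: (star_add_old sP).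
move=> sQ; have /starP [pQ cQ bQ iQ] := sQ.
case JQ: (cover A \in Q).
  constructor 2; apply/eqP; apply: (star_mem_inj sQ (star_add_blockC sP aP) JQ).
  by rewrite !inE eqxx.
case JCQ: (~: cover A \in Q).
  constructor 1; apply/eqP; apply: (star_mem_inj sQ (star_add_block sP aP) JCQ).
  by rewrite !inE eqxx.
constructor 3; apply/andP; split.
  apply/eqP => QP; have [|B BQ] := iQ (cover A); first by rewrite !inE eqxx.
  rewrite QP in BQ; rewrite (negPf (cover_notsub pP AP A1 BQ)) -cC /=.
  by rewrite (negPf (cover_notsub pP (subsetDl _ _) A2 BQ)).
apply/starP; split=> // [B BQ|I sI]; last by apply: iQ; rewrite !inE sI !orbT.
have /orP [|cB] := bQ B BQ; last by rewrite /branch cB orbT.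
rewrite !inE => /or3P [/eqP B1|/eqP B1|sB]; last by rewrite /branch sB.
- by rewrite -B1 BQ in JQ.
- by rewrite -B1 BQ in JCQ.
Qed.

Lemma big_stars_add (R : Type) (idx : R) (op : Monoid.com_law idx)
    (F : {set {set L}} -> R) P A : star s P -> splits_star A P ->
  \big[op/idx]_(Q in stars (add_split s (cover A))) F Q =
  op (op (F (~: cover A |: A)) (F (cover A |: (P :\: A))))
     (\big[op/idx]_(Q in stars s :\ P) F Q).
Proof.
move=> sP aP; have nJ := new_split_star sP aP; have /and4P [sJ J1 J2 _] := nJ.
have /and4P [sJ' _ _ _] := new_splitC nJ.
have JC : cover A != ~: cover A.
  have /card_gt0P [x xJ] : 0 < #|cover A| by lia.
  by apply/eqP => /setP /(_ x); rewrite inE xJ.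
have nb B : B \in [:: cover A; ~: cover A] -> ~~ branch s B.
  rewrite !inE /branch => /orP [] /eqP ->; rewrite ?(negPf sJ) ?(negPf sJ') /=;
  by apply/eqP; lia.
have nP B Q : B \in [:: cover A; ~: cover A] -> star s Q -> B \notin Q.
  by move=> /nb nB /starP [_ _ bQ _]; apply: contra nB => /bQ.
have /and3P [AP _ _] := aP.
rewrite (stars_add sP aP) big_setU1 /=; last first.
  rewrite !inE !negb_or; apply/andP; split; last first.
    rewrite negb_and; apply/orP; right; apply/negP => /(nP (~: cover A)).
    by rewrite !inE eqxx orbT => /(_ isT).
  apply/eqP => /setP /(_ (cover A)); rewrite !inE eqxx (negPf JC) /=.
  by move/(subsetP AP); apply/negP/nP; rewrite // !inE eqxx.
rewrite big_setU1 /=; first by rewrite Monoid.mulmA.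
rewrite !inE negb_and; apply/orP; right; apply/negP => /(nP (cover A)).
by rewrite !inE eqxx => /(_ isT).
Qed.

End Refinement.
End SplitSystems.

(** * Weights of stars *)

Section StarWeights.
Local Open Scope nat_scope.
Variables (L : finType) (k : L -> nat).
Implicit Types (I J B : {set L}) (s P Q A : {set {set L}}).

Definition bweight B := \sum_(i | B == [set i]) k i.

Definition stweight P := \sum_(B in P) bweight B.

(** The value 0 for a vertex violating val = K + 3 lets the product [facetfact] encode the support
    of the fan along with the numerator of the weight. *)
Definition starfact P := if #|P| == stweight P + 3 then (stweight P)`! else 0.

Definition facetfact s := \prod_(P in stars s) starfact P.

Lemma bweight1 i : bweight [set i] = k i.
Proof.
by rewrite /bweight (big_pred1 i) // => j; rewrite (inj_eq set1_inj) eq_sym.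
Qed.

Lemma bweight_gt1 B : 1 < #|B| -> bweight B = 0.
Proof.
by move=> B1; rewrite /bweight big_pred0 // => i; apply/eqP => Bi; move: B1; rewrite Bi cards1.
Qed.

Lemma stweight_addC s P A : split_system s -> star s P -> splits_star A P ->
  [/\ #|~: cover A |: A| = #|A|.+1 & stweight (~: cover A |: A) = stweight A].
Proof.
move=> ss sP aP; have /and4P [_ _ J2 _] := new_split_star sP aP.
have /starP [pP _ _ _] := sP.
have nA : ~: cover A \notin A.
  apply/negP => /sub_cover /subsetP JJ; have /card_gt0P [x] : 0 < #|~: cover A| by lia.
  by move=> xJ; have := JJ x xJ; move: xJ; rewrite inE => /negPf ->.
by rewrite cardsU1 nA /stweight big_setU1 //= bweight_gt1.
Qed.

Lemma stweight_split P A : A \subset P ->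
  stweight A + stweight (P :\: A) = stweight P /\ #|A| + #|P :\: A| = #|P|.
Proof.
move=> AP; split; last by rewrite -(cardsID A P) (setIidPr AP).
by rewrite /stweight [RHS](big_setID A) /= (setIidPr AP).
Qed.

Lemma facetfact_add s P A : split_system s -> star s P -> splits_star A P ->
  facetfact (add_split s (cover A)) =
  (if balanced_part bweight A && balanced_part bweight (P :\: A)
   then (stweight A)`! * (stweight (P :\: A))`! else 0)
  * \prod_(Q in stars s :\ P) starfact Q.
Proof.
move=> ss sP aP; rewrite /facetfact (big_stars_add ss _ _ sP aP) /=.
have [aC cC] := splits_starC sP aP.
have [c1 w1] := stweight_addC ss sP aP.
have := stweight_addC ss sP aC; rewrite cC setCK => -[c2 w2].
congr (_ * _); rewrite /starfact c1 w1 c2 w2 /balanced_part -!/(stweight _).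
rewrite [_.+1 == _](_ : _ = (#|A| == stweight A + 2)); last by lia.
rewrite [_.+1 == _](_ : _ = (#|P :\: A| == stweight (P :\: A) + 2)); last by lia.
by do 2 case: eqP => //=; rewrite muln0.
Qed.

Lemma facetfact_separating s P B C : split_system s -> star s P ->
  B \in P -> C \in P -> B != C ->
  (\sum_(A : {set {set L}} | [&& splits_star A P, B \in A & C \notin A])
     facetfact (add_split s (cover A))) * ((bweight B).+1 * (bweight C).+1) =
  (if #|P| == stweight P + 4
   then (bweight B + bweight C + 2) * (stweight P).+1`! else 0)
  * \prod_(Q in stars s :\ P) starfact Q.
Proof.
move=> ss sP BP CP BC; rewrite -(sum_separating bweight BP CP BC).
rewrite [RHS]mulnAC [in RHS]big_distrl /=; congr (_ * _).
rewrite [RHS](bigID (fun A => splits_star A P)) /= [X in _ + X]big1 ?addn0.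
  apply: eq_big => [A|A /andP [aP _]]; last by rewrite (facetfact_add ss sP aP).
  rewrite /splits_star -!andbA; case: (A \subset P) => //=.
  by rewrite [RHS]andbC -!andbA [RHS]andbC -!andbA; do !case: (_ < _) => //=; rewrite ?andbF ?andbT.
(* A part with fewer than two branches is not balanced, so these A contribute 0. *)
move=> A /andP [/and3P [AP _ _]]; rewrite /splits_star AP /= negb_and -!leqNgt.
rewrite /balanced_part => c; case: eqP => //= c1; case: eqP => //= c2.
by move: c; rewrite c1 c2 !addn2.
Qed.

Lemma card_add_split s J : new_split s J -> split_system s -> #|add_split s J| = #|s|.+2.
Proof.
move=> nJ ss; have /and4P [sJ J1 _ _] := nJ; have /and4P [sJ' _ _ _] := new_splitC ss nJ.
have JC : J != ~: J.
  have /card_gt0P [x xJ] : 0 < #|J| by lia.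
  by apply/eqP => /setP /(_ x); rewrite inE xJ.
by rewrite /add_split !cardsU1 !inE (negPf JC) (negPf sJ) (negPf sJ').
Qed.

(** The inverse of [add_split], on which the inductions over the number of splits rest. *)
Lemma del_split s J : split_system s -> J \in s ->
  let s0 := s :\ J :\ ~: J in
  [/\ split_system s0, new_split s0 J & s = add_split s0 J].
Proof.
move=> /split_systemP [s1 s2 s3] sJ s0.
have sub I : I \in s0 -> I \in s by rewrite !inE => /and3P [].
split.
- apply/split_systemP; split=> [I|I /sub /s2 //|I K /sub sI /sub sK]; last exact: s3.
  rewrite !inE => /and3P [n1 n2 sI]; rewrite s1 // andbT (inj_eq (inv_inj (@setCK _))) n2.
  by apply: contraNN n1 => /eqP <-; rewrite setCK.
- rewrite /new_split !inE eqxx andbF s2 // s2 ?s1 //=.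
  by apply/forall_inP => I /sub sI; apply: s3.
- by apply/setP => I; rewrite !inE; case: eqP => [->|] //=; case: eqP => [->|] //=; rewrite s1.
Qed.

Lemma stars0 : 2 < #|L| -> stars set0 = [set [set [set x] | x in L]].
Proof.
move=> L3; set P0 := [set [set x] | x in L].
have s0 : star set0 P0.
  apply/starP; split.
  - apply/and3P; split.
    + apply/eqP/setP => x; rewrite inE; apply/bigcupP; exists [set x]; last exact/set11.
      exact: imset_f.
    + apply/trivIsetP => _ _ /imsetP [x _ ->] /imsetP [y _ ->] xy.
      by rewrite disjoints1 inE; apply: contraNN xy => /eqP ->.
    + by apply/imsetP => -[x _] /setP /(_ x); rewrite !inE eqxx.
  - by rewrite card_imset //; exact: set1_inj.
  - by move=> _ /imsetP [x _ ->]; rewrite /branch cards1 orbT.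
  - by move=> J; rewrite inE.
apply/setP => Q; rewrite !inE; apply/idP/eqP => [sQ|-> //].
have /starP [pQ _ bQ _] := sQ.
have /card_gt0P [x _] : 0 < #|L| by lia.
have [B BQ xB] := part_ex pQ x.
apply: (star_mem_inj sQ s0 BQ); have := bQ B BQ; rewrite /branch inE /=.
by case/cards1P => y Bxy; apply/imsetP; exists y.
Qed.

(** Induction on the splits, starting from the tree with a single vertex. A new split replaces a
    vertex of valence a + b by two of valences a + 1 and b + 1, and a + b - 3 = (a - 2) + (b - 2) +
    1; the new blocks have weight 0. *)
Lemma stars_count s : 2 < #|L| -> split_system s ->
  \sum_(P in stars s) (#|P| - 3) + #|s|./2 = #|L| - 3 /\
  \sum_(P in stars s) stweight P = \sum_i k i.
Proof.
move=> L3.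
have base : \sum_(P in @stars L set0) (#|P| - 3) + #|@set0 {set L}|./2 = #|L| - 3 /\
    \sum_(P in stars set0) stweight P = \sum_i k i.
  rewrite stars0 // !big_set1 cards0 addn0 card_imset; last exact: set1_inj.
  split=> //; rewrite /stweight big_imset /=; last by move=> x y _ _; apply: set1_inj.
  by apply: eq_big => // i _; rewrite bweight1.
move: {2}#|s| (leqnn #|s|) => m; elim: m s => [|m IH] s cs ss.
  by move: cs; rewrite leqn0 cards_eq0 => /eqP ->.
have [->//|/set0Pn [J sJ]] := eqVneq s set0.
have [ss0 nJ sE] := del_split ss sJ; set t := _ :\ _ in ss0 nJ sE.
have ct : #|s| = #|t|.+2 by rewrite sE card_add_split.
have [IH1 IH2] := IH t ltac:(lia) ss0.
have [P [A [sP aP cA]]] := new_split_ex ss0 nJ.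
have [aC cC] := splits_starC sP aP; have /and3P [AP A1 A2] := aP.
have [c1 w1] := stweight_addC ss0 sP aP.
have := stweight_addC ss0 sP aC; rewrite cC setCK => -[c2 w2].
have [wA cPA] := stweight_split AP.
have Pt : P \in stars t by rewrite inE.
rewrite ct sE -cA !(big_stars_add ss0 _ _ sP aP) /= c1 c2 w1 w2.
move: IH1 IH2; rewrite !(big_setD1 P Pt) /=.
rewrite -wA -cPA /= => <- <-; split=> //.
rewrite addnS -addSn; congr (_ + _); move: A1 A2.
by move: #|A| #|_ :\: _| (\sum_(Q in _) _) => a b c; lia.
Qed.

End StarWeights.

(** * Stars of a tree *)

Section Trees.
Local Open Scope nat_scope.
Variables (n : nat) (T : ctype n).
Implicit Types (x y z u v : T) (I J B : {set 'I_n}) (P : {set {set 'I_n}}).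

Definition vside x y : {set T} :=
  [set z | connect [rel u v : T | adj u v && ([set u; v] != [set x; y])] x z].

Lemma connect_ind (V : finType) (e : rel V) (Q : V -> Prop) a b :
  Q a -> (forall c d, Q c -> e c d -> Q d) -> connect e a b -> Q b.
Proof.
move=> Qa step /connectP [p ep ->]; elim: p a Qa ep => //= c p IH a Qa /andP [ac ep].
by apply: IH ep; apply: step ac.
Qed.

Lemma set2_eq (V : finType) (a b c d : V) :
  ([set a; b] == [set c; d]) = ((a == c) && (b == d)) || ((a == d) && (b == c)).
Proof.
apply/eqP/orP => [E|[] /andP [/eqP -> /eqP ->] //]; last by rewrite setUC.
have /set2P Ha : a \in [set c; d] by rewrite -E set21.
have /set2P Hb : b \in [set c; d] by rewrite -E set22.
have /set2P Hc : c \in [set a; b] by rewrite E set21.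
have /set2P Hd : d \in [set a; b] by rewrite E set22.
case: Ha Hb => aE [] bE; rewrite aE bE ?eqxx /= ?andbT; auto.
  by left; case: Hd => ->; rewrite ?aE ?bE.
by left; case: Hc => ->; rewrite ?aE ?bE.
Qed.

Lemma disjoint_memP (V : finType) (A B : {set V}) :
  reflect (forall w, w \in A -> w \in B -> False) [disjoint A & B].
Proof.
apply: (iffP idP) => [d w wA wB|h]; first by rewrite (disjointFr d wA) in wB.
by rewrite disjoint_subset; apply/subsetP => w wA; rewrite inE; apply/negP; apply: h.
Qed.

Lemma side_vside x y i : (i \in side x y) = (leaf T i \in vside x y).
Proof. by rewrite !inE. Qed.

Lemma vside_self x y : x \in vside x y.
Proof. by rewrite inE connect0. Qed.

Lemma vside_step x y u v : u \in vside x y -> adj u v ->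
  ~~ [|| (u == x) && (v == y) | (u == y) && (v == x)] -> v \in vside x y.
Proof.
rewrite !inE => xu uv nuv; apply: connect_trans xu (connect1 _).
by rewrite /= uv set2_eq.
Qed.

Lemma vside_ind (Q : T -> Prop) x y : Q x ->
  (forall u v, u \in vside x y -> v \in vside x y -> Q u -> adj u v ->
     ~~ [|| (u == x) && (v == y) | (u == y) && (v == x)] -> Q v) ->
  forall z, z \in vside x y -> Q z.
Proof.
move=> Qx step z; rewrite inE => xz.
suff [] : Q z /\ z \in vside x y by [].
move: xz; apply: (connect_ind (Q := fun z => Q z /\ z \in vside x y)).
  by split=> //; apply: vside_self.
move=> c d [Qc cV] /= /andP [cd]; rewrite set2_eq => ncd.
have dV := vside_step cV cd ncd.
by split=> //; apply: (step c d).
Qed.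

Lemma vside_cover x y z : adj x y -> (z \in vside x y) || (z \in vside y x).
Proof.
move=> xy; have := adj_connected x z.
apply: (connect_ind (Q := fun z => (z \in vside x y) || (z \in vside y x))).
  by rewrite vside_self.
move=> u v uV uv.
have [/orP [] /andP [/eqP ux /eqP vy]|nuv] :=
  boolP [|| (u == x) && (v == y) | (u == y) && (v == x)].
- by rewrite vy vside_self orbT.
- by rewrite vy vside_self.
case/orP: uV => uV; first by rewrite (vside_step uV uv nuv).
by rewrite (vside_step uV uv) ?orbT // orbC.
Qed.

(** Acyclicity enters here: a path from y to x avoiding the edge {x, y} would close up with this
    edge to a cycle. *)
Lemma vside_disj x y z : adj x y -> z \in vside x y -> z \notin vside y x.
Proof.
move=> xy; rewrite !inE => xz; apply/negP => yz.
have yxz : connect [rel u v : T | adj u v && ([set u; v] != [set x; y])] y z.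
  by rewrite (setUC [set x]).
have sy : connect_sym [rel u v : T | adj u v && ([set u; v] != [set x; y])].
  by apply: sym_connect_sym => u v /=; rewrite adj_sym (setUC [set u]).
rewrite sy in yxz; have /connectP [p0 pp0 yl0] := connect_trans xz yxz.
case: (shortenP pp0) yl0 => p pp up _ yl {xz yz yxz pp0 p0}.
have := @adj_acyclic _ T (x :: p); rewrite [cycle _ _]/= rcons_path -yl adj_sym xy andbT.
have -> : path (@adj n T) x p by apply: sub_path pp => u v /andP [].
move=> /(_ isT up); case: p pp up yl => [|a [|//]] /=.
  by move=> _ _ yx _; move: xy; rewrite yx adj_irr.
by rewrite andbT => /andP [_ +] _ ya _; rewrite ya eqxx.
Qed.

Lemma vsideE x y z : adj x y -> (z \in vside y x) = (z \notin vside x y).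
Proof.
move=> xy; apply/idP/idP => [|nz].
  by apply: contraTN => /(vside_disj xy).
by have := vside_cover z xy; rewrite (negPf nz).
Qed.

Lemma adj_neq x y : adj x y -> x != y.
Proof. by apply: contraTneq => ->; rewrite adj_irr. Qed.

Lemma vside_notin x y : adj x y -> y \notin vside x y.
Proof. by move=> xy; rewrite -vsideE // vside_self. Qed.

(* Inside vside u v the vertex x is never met, hence neither is {x, y}. *)
Lemma vside_sub x y u v : adj x y -> adj u v -> x \notin vside u v -> u \in vside y x ->
  vside u v \subset vside y x.
Proof.
move=> xy uv xn uy; apply/subsetP => z.
apply: (vside_ind (Q := fun z => z \in vside y x)) => // a b aV bV ay ab _.
have an : a != x by apply: contraNneq xn => <-.
have bn : b != x by apply: contraNneq xn => <-.
by apply: (vside_step ay ab); rewrite (negPf an) (negPf bn) andbF.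
Qed.

Lemma vside_child x y z : adj x y -> adj y z -> z != x -> vside z y \subset vside y x.
Proof.
move=> xy yz zx.
have zy : z \in vside y x.
  apply: (vside_step (vside_self y x) yz).
  by rewrite (negPf zx) eq_sym (negPf (adj_neq xy)) andbF.
apply: vside_sub => //; first by rewrite adj_sym.
rewrite -vsideE; last by rewrite adj_sym.
apply: (vside_step (vside_self y z)); first by rewrite adj_sym.
by rewrite (eq_sym x) (negPf zx) (negPf (adj_neq yz)) andbF.
Qed.

Lemma vside_sib x y z : adj x y -> adj x z -> y != z ->
  [disjoint vside y x & vside z x].
Proof.
move=> xy xz yz; rewrite disjoint_sym; apply/disjoint_memP => w wz wy.
have yx : adj y x by rewrite adj_sym.
have := subsetP (vside_child yx xz _) w wz; rewrite eq_sym => /(_ yz).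
by rewrite (vsideE w yx) wy.
Qed.

Lemma vside_ex x w : w != x -> exists2 y, adj x y & w \in vside y x.
Proof.
suff : w = x \/ exists2 y, adj x y & w \in vside y x.
  by case=> // ->; rewrite eqxx.
have := adj_connected x w.
apply: (connect_ind (Q := fun w => w = x \/ exists2 y, adj x y & w \in vside y x)); first by left.
move=> c d [->|[y xy cy]] cd.
  by right; exists d => //; apply: vside_self.
have [/orP [] /andP [/eqP c' /eqP d']|ncd] :=
  boolP [|| (c == y) && (d == x) | (c == x) && (d == y)].
- by left.
- by right; exists y; rewrite // d' vside_self.
by right; exists y => //; apply: (vside_step cy cd).
Qed.

Lemma edge_branch u v x : adj u v -> x \in vside v u ->
  exists2 y, adj x y & vside u v \subset vside y x.
Proof.
move=> uv xv; have xn : x \notin vside u v by rewrite -vsideE.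
have ux : u != x by apply: contraNneq xn => <-; apply: vside_self.
have [y xy uy] := vside_ex ux.
by exists y => //; apply: vside_sub.
Qed.

Lemma sideC x y : adj x y -> side y x = ~: side x y.
Proof. by move=> xy; apply/setP => i; rewrite in_setC !side_vside vsideE. Qed.

Lemma side_sub x y u v : vside u v \subset vside y x -> side u v \subset side y x.
Proof. by move/subsetP => h; apply/subsetP => i; rewrite !side_vside => /h. Qed.

(** If no leaf is attached to y, stability provides an edge at y other than {x, y}; beyond it lies a
    smaller part of the tree, to which induction applies. *)
Lemma side_neq0 x y : adj x y -> side y x != set0.
Proof.
move: {2}#|vside y x| (leqnn #|vside y x|) => m.
elim: m x y => [|m IH] x y cm xy.
  by move: cm; rewrite leqn0 cards_eq0 => /eqP /setP /(_ y); rewrite vside_self inE.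
have [/card_gt0P [i]|] := boolP (0 < #|[set i | leaf T i == y]|).
  by rewrite inE => /eqP iy; apply/set0Pn; exists i; rewrite side_vside iy vside_self.
rewrite -eqn0Ngt => /eqP l0; have := adj_stable y; rewrite l0 addn0 => c3.
have [z yz zx] : exists2 z, adj y z & z != x.
  have : [set z | adj y z] :\ x != set0.
    by rewrite -card_gt0; move: c3; rewrite (cardsD1 x); lia.
  by case/set0Pn => z; rewrite !inE => /andP [zx yz]; exists z.
have sz := vside_child xy yz zx.
have : side z y != set0.
  apply: IH => //; rewrite -ltnS; apply: leq_trans cm; apply: proper_card.
  apply/properP; split=> //; exists y; first exact: vside_self.
  by rewrite vside_notin // adj_sym.
by case/set0Pn => i iz; apply/set0Pn; exists i; apply: (subsetP (side_sub sz)).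
Qed.

Definition vstar x : {set {set 'I_n}} :=
  [set side y x | y in [set y | adj x y]] :|: [set [set i] | i in [set i | leaf T i == x]].

Lemma vstarP x B : reflect ((exists2 y, adj x y & B = side y x) \/
    (exists2 i, leaf T i = x & B = [set i])) (B \in vstar x).
Proof.
rewrite inE; apply: (iffP orP) => -[].
- by case/imsetP => y; rewrite inE; left; exists y.
- by case/imsetP => i; rewrite inE => /eqP; right; exists i.
- by case=> y xy ->; left; apply: imset_f; rewrite inE.
- by case=> i xi ->; right; apply: imset_f; rewrite inE xi.
Qed.

Lemma side_sib x y z : adj x y -> adj x z -> y != z -> [disjoint side y x & side z x].
Proof.
move=> xy xz yz; apply/disjoint_memP => i; rewrite !side_vside.
by move/disjoint_memP: (vside_sib xy xz yz); apply.
Qed.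

Lemma side_inj x : {in [set y | adj x y] &, injective (fun y => side y x)}.
Proof.
move=> y z; rewrite !inE => xy xz yz; apply/eqP; apply: contraT => nyz.
have /set0Pn [i iy] := side_neq0 xy.
by have /disjoint_memP/(_ _ iy) := side_sib xy xz nyz; rewrite -yz => /(_ iy).
Qed.

Lemma vside_leaf x y i : adj x y -> leaf T i = x -> i \notin side y x.
Proof. by move=> xy xi; rewrite side_vside (vsideE _ xy) negbK xi vside_self. Qed.

Lemma vstar_part x : partition (vstar x) setT.
Proof.
apply/and3P; split.
- apply/eqP/setP => i; rewrite inE; apply/bigcupP.
  have [ix|/vside_ex [y xy iy]] := eqVneq (leaf T i) x.
    by exists [set i]; rewrite ?set11 //; apply/vstarP; right; exists i.
  by exists (side y x); rewrite ?side_vside //; apply/vstarP; left; exists y.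
- apply/trivIsetP => B C /vstarP [[y xy ->]|[i xi ->]] /vstarP [[z xz ->]|[j xj ->]] nBC.
  + by apply: side_sib => //; apply: contraNneq nBC => ->.
  + by rewrite disjoint_sym disjoints1 vside_leaf.
  + by rewrite disjoints1 vside_leaf.
  + by rewrite disjoints1 inE; apply: contraNneq nBC => ->.
- apply/vstarP => -[[y xy B0]|[i _ /setP /(_ i)]]; last by rewrite !inE eqxx.
  by have := side_neq0 xy; rewrite -B0 eqxx.
Qed.

Lemma vstar_card x : #|vstar x| = valence x.
Proof.
rewrite /vstar cardsU (card_in_imset (@side_inj x)) card_imset; last exact: set1_inj.
rewrite (_ : _ :&: _ = set0) ?cards0 ?subn0 //; apply/setP => B; rewrite !inE.
apply/negP => /andP [/imsetP [y]]; rewrite inE => xy -> /imsetP [i].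
rewrite inE => /eqP xi yi; have := vside_leaf xy xi; by rewrite yi inE eqxx.
Qed.

Lemma splitsP I : reflect (exists x y, adj x y /\ I = side x y) (I \in splits T).
Proof.
rewrite inE; apply: (iffP existsP) => [[x /existsP [y /andP [xy /eqP ->]]]|[x [y [xy ->]]]].
  by exists x, y.
by exists x; apply/existsP; exists y; rewrite xy eqxx.
Qed.

Lemma vstar_star x : star (splits T) (vstar x).
Proof.
apply/starP; split; first exact: vstar_part.
- by rewrite vstar_card; apply: adj_stable.
- move=> B /vstarP [[y xy ->]|[i _ ->]]; last by rewrite /branch cards1 orbT.
  by rewrite /branch; apply/orP; left; apply/splitsP; exists y, x; rewrite adj_sym.
move=> J /splitsP [u [v [uv ->]]].
have vu : adj v u by rewrite adj_sym.
case/orP: (vside_cover x uv) => xV.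
  have [y xy sy] := edge_branch vu xV; exists (side y x); first by apply/vstarP; left; exists y.
  by rewrite -sideC // (side_sub sy) orbT.
have [y xy sy] := edge_branch uv xV; exists (side y x); first by apply/vstarP; left; exists y.
by rewrite (side_sub sy).
Qed.

(** A side consisting of one label would lie in one branch at its end vertex y, and this branch
    would cover everything together with the branch on the other side of the edge. Nestedness holds
    since one split is a block of the star at y, and the other or its complement lies in some block
    there. *)
Lemma splits_split_system : split_system (splits T).
Proof.
have s2 x y : adj x y -> 1 < #|side y x|.
  move=> xy; have yx : adj y x by rewrite adj_sym.
  have /starP [pP cP _ _] := vstar_star y.
  have B1 : side x y \in vstar y by apply/vstarP; left; exists x.
  rewrite sideC // -[#|_|]prednK; last by rewrite card_gt0 -sideC // side_neq0.
  rewrite ltnS lt0n; apply/negP => /eqP c1.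
  have /cards1P [i iE] : #|~: side x y| == 1.
    have : #|~: side x y| > 0 by rewrite card_gt0 -sideC // side_neq0.
    by move: c1; lia.
  have [B BP iB] := part_ex pP i.
  by case: (part_subC pP cP B1 BP); rewrite iE sub1set.
apply/split_systemP; split.
- move=> _ /splitsP [x [y [xy ->]]]; apply/splitsP; exists y, x.
  by split; rewrite ?(sideC xy) // adj_sym.
- by move=> _ /splitsP [x [y [xy ->]]]; apply: s2; rewrite adj_sym.
move=> I J sI /splitsP [x [y [xy ->]]].
have /starP [pP _ _ iP] := vstar_star y.
have Jy : side x y \in vstar y by apply/vstarP; left; exists x; rewrite // adj_sym.
have [B BP IB] := iP I sI.
have [BJ|/(part_disj pP BP Jy) BJ] := eqVneq B (side x y).
  by move: IB; rewrite BJ /nested => /orP [] ->; rewrite ?orbT.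
by case/orP: IB => IB; rewrite /nested (subset_trans IB BJ) ?orbT.
Qed.

(** For distinct vertices the branches pointing at each other cover all labels, so they cannot be
    blocks of the same star. *)
Lemma vstar_inj : injective vstar.
Proof.
move=> x z xz; apply/eqP; apply: contraT => nxz.
have [y xy zy] : exists2 y, adj x y & z \in vside y x.
  by apply: vside_ex; rewrite eq_sym.
have [w zw xw] := vside_ex nxz.
have /starP [pP cP _ _] := vstar_star x.
have yx : adj y x by rewrite adj_sym.
case: (@part_subC _ (vstar x) pP (side y x) (side w z)) => //.
- by apply/vstarP; left; exists y.
- by rewrite xz; apply/vstarP; left; exists w.
rewrite -sideC //; apply: side_sub; apply: vside_sub => //.
by rewrite -(vsideE z xy).
Qed.

(* If the star Q is not at x, some branch of x contains all but one block of Q;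
   moving along that branch gets closer to Q. *)
Lemma vstar_surj Q : star (splits T) Q -> exists x, vstar x = Q.
Proof.
move=> sQ; have /starP [pQ cQ bQ iQ] := sQ.
have next x : vstar x != Q -> exists y, [/\ adj x y &
    exists2 B, B \in Q & ~: side y x \subset B].
  move=> nxQ; have sx := vstar_star x; have /starP [px cx bx ix] := sx.
  have [[B Bx [C CQ BC]]|nB] := pselect
    (exists2 B, B \in vstar x & exists2 C, C \in Q & ~: B \subset C).
    case/vstarP: Bx BC => [[y xy ->] BC|[i xi ->] BC]; first by exists y; split=> //; exists C.
    have [D DQ iD] := part_ex pQ i.
    case: (part_subC pQ cQ CQ DQ); rewrite subCset in BC.
    by apply: subset_trans BC _; rewrite sub1set.
  case/eqP: nxQ; apply: (refine_eq px pQ) => B BP.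
    have [C CQ /orP [BC|BC]] := star_branch sQ (bx B BP); first by exists C.
    by case: nB; exists B => //; exists C.
  have [C Cx /orP [BC|BC]] := star_branch sx (bQ B BP); first by exists C.
  have [D DQ /orP [CD|CD]] := star_branch sQ (bx C Cx); last first.
    by case: nB; exists C => //; exists D.
  by case: (part_subC pQ cQ BP DQ); apply: subset_trans BC CD.
have walk m x y : adj x y -> #|side y x| <= m ->
    (exists2 B, B \in Q & ~: side y x \subset B) -> exists x, vstar x = Q.
  elim: m x y => [|m IH] x y xy cm [B BQ sB].
    by have := side_neq0 xy; rewrite -cards_eq0 -leqn0 cm.
  have [|/next [z [yz [C CQ sC]]]] := eqVneq (vstar y) Q; first by exists y.
  have yx : adj y x by rewrite adj_sym.
  (* Turning back to x would mean that the blocks B and C of Q cover all labels. *)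
  have zx : z != x.
    apply: contraTneq isT => zx; case: (part_subC pQ cQ BQ CQ).
    rewrite subCset in sB; apply: subset_trans sB _.
    by rewrite (sideC xy) -zx.
  apply: (IH y z) => //; last by exists C.
  rewrite -ltnS; apply: leq_trans cm; apply: proper_card.
  rewrite properE (side_sub (vside_child xy yz zx)) /= (sideC xy).
  have /starP [py cy _ _] := vstar_star y.
  apply/negP; apply: (part_subC py cy); apply/vstarP; left; first by exists x.
  by exists z.
have /card_gt0P [B BQ] : 0 < #|Q| by lia.
have /set0Pn [i _] := part_neq0 pQ BQ.
have [|/next [y [xy sy]]] := eqVneq (vstar (leaf T i)) Q; first by exists (leaf T i).
exact: (walk _ _ _ xy (leqnn _)).
Qed.

End Trees.

(** * Realization of split systems *)

(* A split system is realised by the tree of the sets of labels that lie below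
   an edge when the leaf r is taken as root, ordered by inclusion. *)
Section Realization.
Local Open Scope nat_scope.
Variables (n : nat) (s : {set {set 'I_n}}) (r : 'I_n).
Hypotheses (n3 : 2 < n) (ss : split_system s).

(** Each edge stands for the vertex at its lower end. The cluster ~: [set r] belongs to the leaf r
    and so stands for the vertex to which r is attached. *)
Definition clusters : {set {set 'I_n}} := ~: [set r] |: [set I in s | r \notin I].

Definition cluster := {I : {set 'I_n} | I \in clusters}.

Implicit Types (x y z u v : cluster).

Lemma root_in : ~: [set r] \in clusters. Proof. by rewrite !inE eqxx. Qed.

Definition root : cluster := exist _ (~: [set r]) root_in.

Definition parent x y := (val x \proper val y) &&
  [forall z : cluster, (val x \proper val z) ==> (val y \subset val z)].

Definition cadj x y := parent x y || parent y x.

(** The label r lies in no cluster, hence its separate case; all other labels lie in [root], the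
    default of the minimum. *)
Definition cleaf (i : 'I_n) : cluster :=
  if i == r then root else [arg min_(x < root | i \in val x) #|val x|].

Lemma notin_cluster x : r \notin val x.
Proof.
have := valP x; rewrite !inE => /orP [/eqP ->|/andP [] //].
by rewrite !inE eqxx.
Qed.

Lemma sub_root x : val x \subset val root.
Proof.
apply/subsetP => i ix; rewrite !inE; apply: contraTneq ix => ->.
exact: notin_cluster.
Qed.

Lemma card_cluster x : 1 < #|val x|.
Proof.
have [_ s2 _] := split_systemP s ss.
have := valP x; rewrite inE => /orP [/set1P ->|].
  by rewrite cardsC1 card_ord; lia.
by rewrite inE => /andP [/s2].
Qed.

(** Of the four cases of [nested], the common label i excludes disjointness, and r, lying outside
    both, excludes that they cover everything. *)
Lemma laminar x y i : i \in val x -> i \in val y ->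
  (val x \subset val y) || (val y \subset val x).
Proof.
move=> ix iy; have := valP x; rewrite inE => /orP [/set1P ->|].
  by rewrite (sub_root y) orbT.
rewrite inE => /andP [sx _]; have := valP y; rewrite inE => /orP [/set1P ->|].
  by rewrite (sub_root x).
rewrite inE => /andP [sy _]; have [_ _ s3] := split_systemP s ss.
case/or4P: (s3 _ _ sx sy) => sub.
- by rewrite sub.
- by have := subsetP sub i ix; rewrite inE iy.
- have := subsetP sub r; rewrite inE (negPf (notin_cluster x)) => /(_ isT).
  by rewrite (negPf (notin_cluster y)).
- by rewrite setCS in sub; rewrite sub orbT.
Qed.

Lemma parent_inj x y z : parent x y -> parent x z -> y = z.
Proof.
case/andP => xy /forallP my /andP [xz /forallP mz]; apply/val_inj/eqP.
by rewrite eqEsubset (implyP (my z)) // (implyP (mz y)).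
Qed.

Lemma parent_ex x : x != root -> exists y, parent x y.
Proof.
move=> xr; have xroot : val x \proper val root.
  by rewrite properEneq sub_root andbT; apply: contra xr => /eqP /val_inj ->.
case: (@arg_minnP _ root (fun y => val x \proper val y) (fun y => #|val y|) xroot).
move=> y xy ymin; exists y; rewrite /parent xy; apply/forallP => z; apply/implyP => xz.
have /card_gt0P [i ix] := ltnW (card_cluster x).
have iy := subsetP (proper_sub xy) i ix; have iz := subsetP (proper_sub xz) i ix.
case/orP: (laminar iy iz) => // zy; have := ymin z xz.
by rewrite leqNgt; apply: contraNT => nyz; apply: proper_card; rewrite properE zy.
Qed.

Lemma cadj_sym : symmetric cadj. Proof. by move=> x y; rewrite /cadj orbC. Qed.

Lemma parent_proper x y : parent x y -> val x \proper val y.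
Proof. by case/andP. Qed.

Lemma cadj_irr : irreflexive cadj.
Proof. by move=> x; rewrite /cadj orbb /parent properxx. Qed.

Lemma connect_root x : connect cadj x root.
Proof.
move: {2}(#|val root| - #|val x|) (leqnn (#|val root| - #|val x|)) => m.
elim: m x => [|m IH] x cm; have [->|/parent_ex [y xy]] := eqVneq x root;
  rewrite ?connect0 //; have cxy := proper_card (parent_proper xy).
  by have := subset_leq_card (sub_root y); lia.
apply: connect_trans (connect1 _) (IH y _); first by rewrite /cadj xy.
by have := subset_leq_card (sub_root y); lia.
Qed.

Lemma cadj_connected x y : connect cadj x y.
Proof.
apply: connect_trans (connect_root x) _.
by rewrite (sym_connect_sym cadj_sym) connect_root.
Qed.

(** At a smallest cluster of a cycle both cyclic neighbours are parents. Since parents are unique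
    they coincide, so the cycle has at most two vertices. *)
Lemma cadj_acyclic (c : seq cluster) : cycle cadj c -> uniq c -> size c <= 2.
Proof.
case: c => [|x0 c0] // cyc un; set c := x0 :: c0 in cyc un *.
have x0c : x0 \in c by rewrite inE eqxx.
case: (@arg_minnP _ x0 (fun x => x \in c) (fun x => #|val x|) x0c) => x xc xmin.
have up y : y \in c -> cadj x y -> parent x y.
  move=> /xmin cy /orP [] // /parent_proper /proper_card; lia.
have [i p cE] := rot_to xc; move: cyc un; rewrite -(rot_cycle i) -(rot_uniq i).
have mem y : y \in x :: p -> y \in c by rewrite -cE mem_rot.
rewrite -(size_rot i) cE; case: p mem {cE} => [|a p] //= mem.
rewrite rcons_path => /and3P [xa _ lx] /and3P [_ ap _].
have pa : parent x a by apply: up => //; apply: mem; rewrite !inE eqxx orbT.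
have pl : parent x (last a p).
  by apply: up; [apply: mem; rewrite inE mem_last orbT | rewrite cadj_sym].
have := parent_inj pa pl; case: p ap {mem lx pl} => [|b p] //= ap E.
by rewrite E mem_last in ap.
Qed.

Lemma mem_cleaf i : i != r -> i \in val (cleaf i) /\
  forall x, i \in val x -> val (cleaf i) \subset val x.
Proof.
move=> ir; rewrite /cleaf (negPf ir).
case: (@arg_minnP _ root (fun y => i \in val y) (fun y => #|val y|)); first by rewrite !inE.
move=> y iy ymin; split=> // x ix; case/orP: (laminar iy ix) => // xy.
have := ymin x ix; rewrite leqNgt; apply: contraNT => nyx.
by apply: proper_card; rewrite properE xy.
Qed.

Lemma child_ex x i : i \in val x -> cleaf i != x -> exists2 y, parent y x & i \in val y.
Proof.
move=> ix lx; have ir : i != r by apply: contraTneq ix => ->; exact: notin_cluster.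
have [il lmin] := mem_cleaf ir.
have lx' : (i \in val (cleaf i)) && (val (cleaf i) \proper val x).
  by rewrite il properEneq lmin // andbT; apply: contra lx => /eqP /val_inj ->.
case: (@arg_maxnP _ (cleaf i) (fun y => (i \in val y) && (val y \proper val x))
  (fun y => #|val y|) lx') => y /andP [iy yx] ymax.
exists y => //; rewrite /parent yx; apply/forallP => z; apply/implyP => yz.
have iz := subsetP (proper_sub yz) i iy.
case/orP: (laminar ix iz) => // zx; apply: contraT => nxz.
have := ymax z; rewrite iz properE zx nxz => /(_ isT).
by rewrite /= leqNgt (proper_card yz).
Qed.

(** The children of x and the leaves at x other than r cover x, while none of them is all of x, so
    there are at least two. A third branch is the parent or, at the root, the leaf r. *)
Lemma cadj_stable x : 3 <= #|[set y | cadj x y]| + #|[set i | cleaf i == x]|.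
Proof.
set N := [set y | cadj x y]; set Lf := [set i | cleaf i == x].
pose Ch := [set y | parent y x].
pose D : {set {set 'I_n}} := [set val y | y in Ch] :|: [set [set i] | i in Lf :\ r].
have cD : cover D = val x.
  apply/setP => i; apply/bigcupP/idP => [[B]|ix].
    rewrite inE => /orP [/imsetP [y]|/imsetP [j]].
      by rewrite inE => /parent_proper /proper_sub /subsetP yx ->; apply: yx.
    rewrite !inE => /andP [jr /eqP jx] ->; rewrite inE => /eqP ->.
    by rewrite -jx; have [] := mem_cleaf jr.
  have ir : i != r by apply: contraTneq ix => ->; exact: notin_cluster.
  have [lx|/child_ex] := eqVneq (cleaf i) x.
    exists [set i]; last exact: set11.
    by rewrite inE imset_f ?orbT // !inE ir lx eqxx.
  by case/(_ ix) => y yx iy; exists (val y) => //; rewrite inE imset_f ?inE.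
have D2 : 1 < #|D|.
  apply: (cover_card (subxx D)); rewrite cD.
    by rewrite -card_gt0; have := card_cluster x; lia.
  rewrite inE; apply/norP; split.
    by apply/imsetP => -[y]; rewrite inE => /parent_proper + xy; rewrite -xy properxx.
  by apply/imsetP => -[i _ xi]; have := card_cluster x; rewrite xi cards1.
have cDle : #|D| <= #|Ch| + #|Lf :\ r|.
  by rewrite cardsU; apply: leq_trans (leq_subr _ _) (leq_add _ _); apply: leq_imset_card.
have [xr|nxr] := eqVneq x root.
  have rL : r \in Lf by rewrite inE /cleaf eqxx xr.
  have cN : #|Ch| <= #|N|.
    by apply/subset_leq_card/subsetP => y; rewrite !inE /cadj => ->; rewrite orbT.
  by rewrite (cardsD1 r Lf) rL; lia.
have [p xp] := parent_ex nxr.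
have pN : p \in N by rewrite inE /cadj xp.
have cN : #|Ch| <= #|N :\ p|.
  apply/subset_leq_card/subsetP => y; rewrite !inE /cadj => yx; rewrite yx orbT andbT.
  apply: contraTneq yx => ->; apply/negP => /parent_proper px.
  by have := proper_trans (parent_proper xp) px; rewrite properxx.
have cL : #|Lf :\ r| <= #|Lf| by apply/subset_leq_card/subD1set.
by rewrite (cardsD1 p N) pN; lia.
Qed.

Definition cluster_tree : ctype n :=
  CType cadj_sym cadj_irr cadj_connected cadj_acyclic cadj_stable.

(** Once the edge from x to its parent is deleted, no step leads out of the clusters inside x.
    Conversely, from a cluster inside x the chain of parents climbs up to x. *)
Lemma cluster_vside (x y z : cluster_tree) : parent x y ->
  (z \in vside x y) = (val z \subset val x).
Proof.
move=> xy; have xyp := parent_proper xy; apply/idP/idP => [|zx].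
  apply: (@vside_ind _ cluster_tree (fun z : cluster => val z \subset val x)) => //.
  move=> u v _ _ ux uv nuv.
  case/orP: uv => [uv|/parent_proper /proper_sub vu]; last exact: subset_trans vu ux.
  have [ux'|nux] := eqVneq u x.
    by move: nuv; rewrite ux' eqxx /= -(parent_inj xy (_ : parent x v)) ?eqxx // -ux'.
  case/andP: uv => _ /forallP /(_ x) /implyP; apply.
  by rewrite properEneq ux andbT; apply: contra nux => /eqP /val_inj ->.
have climb m : forall w : cluster, val w \subset val x -> #|val x| - #|val w| <= m ->
    (w : cluster_tree) \in vside x y.
  have xx : (x : cluster_tree) \in vside x y by exact: (@vside_self _ cluster_tree).
  elim: m => [|m IH] w wx cm.
    suff -> : w = x by [].
    by apply/val_inj/eqP; rewrite eqEcard wx /= -subn_eq0 -leqn0.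
  have [->//|nwx] := eqVneq w x.
  have wxp : val w \proper val x.
    by rewrite properEneq wx andbT; apply: contra nwx => /eqP /val_inj ->.
  have nwr : w != root.
    by apply: contraTneq wxp => ->; rewrite properE (sub_root x) andbF.
  have [u wu] := parent_ex nwr; have /andP [wup /forallP /(_ x) /implyP /(_ wxp) ux] := wu.
  apply: (@vside_step _ cluster_tree x y u w).
  - apply: (IH u ux); rewrite -ltnS; apply: leq_trans cm.
    exact: ltn_sub2l (proper_card wxp) (proper_card wup).
  - by rewrite /= /cadj wu orbT.
  rewrite negb_or !negb_and; apply/andP; split; apply/orP.
    right; apply: contraTneq wx => ->.
    by move: xyp; rewrite properE => /andP [].
  left; apply: contraTneq ux => ->.
  by move: xyp; rewrite properE => /andP [].
exact: (climb _ z zx (leqnn _)).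
Qed.

Lemma cluster_side (x y : cluster_tree) : parent x y -> side x y = val x.
Proof.
move=> xy; apply/setP => i; rewrite side_vside cluster_vside //=.
have [->|ir] := eqVneq i r.
  rewrite (negPf (notin_cluster x)) /cleaf eqxx; apply/negP => rx.
  have := parent_proper xy; rewrite properE => /andP [_]; rewrite (subset_trans (sub_root y)) //.
have [il lmin] := mem_cleaf ir.
by apply/idP/idP => [/subsetP /(_ i il)|/lmin].
Qed.

(** Of each complementary pair in [s] exactly one member misses r, and it is the side below an edge.
    The root yields no edge to a parent, and it is not in [s], as its complement is a single
    label. *)
Lemma splits_cluster_tree : splits cluster_tree = s.
Proof.
have [s1 s2 _] := split_systemP s ss.
have notroot (x y : cluster_tree) : parent x y -> val x \in s.
  move=> xy; have := valP x; rewrite inE => /orP [/set1P xr|]; last first.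
    by rewrite inE => /andP [].
  by have := parent_proper xy; rewrite properE xr (sub_root y) andbF.
apply/setP => I; apply/splitsP/idP => [[x [y [xy ->]]]|sI].
  case/orP: xy => xy; first by rewrite cluster_side // (notroot x y).
  by rewrite sideC ?cluster_side ?s1 ?(notroot y x) // /= /cadj xy ?orbT.
have low J : J \in s -> r \notin J -> exists x y : cluster_tree, parent x y /\ val x = J.
  move=> sJ rJ; have JF : J \in clusters by rewrite !inE sJ rJ orbT.
  have nJr : exist _ J JF != root.
    apply/eqP => /(congr1 val) /= Jr; have := s2 _ (s1 J sJ).
    by rewrite Jr setCK cards1.
  by have [y xy] := parent_ex nJr; exists (exist _ J JF), y.
case rI: (r \in I); last first.
  have [|x [y [xy <-]]] := low I sI; first by rewrite rI.
  by exists x, y; rewrite cluster_side //= /cadj xy.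
have [|x [y [xy xI]]] := low (~: I) (s1 I sI); first by rewrite inE rI.
exists y, x; rewrite sideC ?cluster_side ?xI ?setCK //= /cadj xy ?orbT //.
Qed.

End Realization.

Lemma is_coneE n (s : {set {set 'I_n}}) : (2 < n)%N -> is_cone s = split_system s.
Proof.
move=> n3; apply/asboolP/idP => [[T <-]|ss]; first exact: splits_split_system.
have r : 'I_n by apply: (@Ordinal n 0); lia.
by exists (cluster_tree r n3 ss); apply: splits_cluster_tree.
Qed.

(** * Coordinates on Q_n and the functions f_k *)

Section Coordinates.
Variables (R : realType) (n : nat).
Implicit Types (v w : Vn R n) (I J S B : {set 'I_n}) (p : pair n) (s : {set {set 'I_n}}).

(** Indexing by sets removes the ordering of the pairs and gives 0 at [set k; k], the distance of a
    label from itself. *)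
Definition entry S v : R := \sum_(p : pair n | pset p == S) v p.

Definition split_vec I : Vn R n := [ffun p => (#|I :&: pset p| == 1%N)%:R].

Lemma vI_split_vec I : vI R I = piQ (split_vec I). Proof. by []. Qed.

Lemma pair_neq p : (val p).1 != (val p).2.
Proof. by have := valP p; apply: contraTneq => ->; rewrite ltnn. Qed.

Lemma card_pset p : #|pset p| = 2%N. Proof. by rewrite cards2 pair_neq. Qed.

Lemma pset_inj : injective (@pset n).
Proof.
move=> p q /eqP; rewrite /pset set2_eq => /orP [] /andP [/eqP e1 /eqP e2].
  by apply: val_inj; rewrite [LHS]surjective_pairing [RHS]surjective_pairing e1 e2.
have := valP p; have := valP q; rewrite e1 e2 => lt1 lt2.
by have := ltn_trans lt1 lt2; rewrite ltnn.
Qed.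

Lemma pset_ex i j : i != j -> exists p, pset p = [set i; j].
Proof.
move=> ij; have [lt|lt|/val_inj eij] := ltngtP i j; last by rewrite eij eqxx in ij.
  by exists (exist _ (i, j) lt).
by exists (exist _ (j, i) lt); rewrite /pset /= setUC.
Qed.

Lemma entry_pset p v : entry (pset p) v = v p.
Proof. by rewrite /entry (big_pred1 p) // => q; rewrite (inj_eq pset_inj). Qed.

Lemma entry_is_linear S : linear_for *%R (entry S).
Proof.
move=> c v w; rewrite /entry mulr_sumr -big_split /=; apply: eq_bigr => p _.
by rewrite !ffunE.
Qed.

Lemma entry1 i v : entry [set i] v = 0.
Proof.
by rewrite /entry big_pred0 // => p; apply/negP => /eqP pi; have := card_pset p; rewrite pi cards1.
Qed.

Lemma pairI_eq1 I i j : i != j -> (#|I :&: [set i; j]| == 1%N) = ((i \in I) != (j \in I)).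
Proof.
move=> ij; rewrite -sum1_card (eq_bigl (fun x => (x \in [set i; j]) && (x \in I))).
  by rewrite big_mkcondr big_setU1 ?inE //= big_set1; case: (i \in I); case: (j \in I).
by move=> x; rewrite inE andbC.
Qed.

Lemma entry_split_vec I i j : i != j ->
  entry [set i; j] (split_vec I) = ((i \in I) != (j \in I))%:R.
Proof.
by move=> ij; have [p pE] := pset_ex ij; rewrite -pE entry_pset ffunE pE pairI_eq1.
Qed.

Lemma split_vecC I : split_vec (~: I) = split_vec I.
Proof.
apply/ffunP => p; rewrite !ffunE /pset !pairI_eq1 ?pair_neq // !inE.
by case: (_ \in I); case: (_ \in I).
Qed.

Lemma split_vec1 i : split_vec [set i] = Phi (fun j => (j == i)%:R).
Proof.
apply/ffunP => p; rewrite !ffunE /pset pairI_eq1 ?pair_neq //.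
rewrite big_setU1 ?inE ?pair_neq // big_set1 ?inE.
have := pair_neq p; case: (eqVneq (val p).1 i) => [->|_ _].
  by rewrite eq_sym => /negPf ->; rewrite /= addr0.
by rewrite /= add0r; case: (_ == i).
Qed.

Lemma piQ0 : piQ (0 : Vn R n) = 0.
Proof. by rewrite -(subrr (0 : Vn R n)) piQB subrr. Qed.

Lemma vI1 (i : 'I_n) : vI R [set i] = 0.
Proof.
rewrite vI_split_vec -piQ0; apply/piQ_eq; rewrite subr0 split_vec1.
by apply/asboolP; eexists.
Qed.

(** * Gromov products at a label k and the function f_k *)

Section Functional.
Variable k : 'I_n.

(* The Gromov product (i|j)_k for S = {i, j}, i.e. the coordinate of v at v_S,
   defined up to a common constant. *)
Definition gromov S v : R := 2^-1 * (\sum_(i in S) entry [set k; i] v - entry S v).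

Lemma gromov_is_linear S : linear_for *%R (gromov S).
Proof.
move=> c v w; rewrite /gromov entry_is_linear.
under eq_bigr do rewrite entry_is_linear.
by rewrite big_split /= -mulr_sumr; ring.
Qed.

HB.instance Definition _ S :=
  GRing.isLinear.Build R (Vn R n) R _ (gromov S) (gromov_is_linear S).

Lemma pairs_offP S : reflect (exists i j, [/\ i != j, k != i, k != j & S = [set i; j]])
  (S \in pairs_off k).
Proof.
rewrite inE; apply: (iffP andP) => [[/cards2P [i [j [ij ->]]]]|[i [j [ij ki kj ->]]]].
  by rewrite !inE negb_or => /andP [ki kj]; exists i, j.
by rewrite cards2 ij !inE negb_or ki kj.
Qed.

Lemma gromov_Phi S a : S \in pairs_off k -> gromov S (Phi a) = a k.
Proof.
case/pairs_offP => i [j [ij ki kj ->]]; rewrite /gromov big_setU1 ?inE //= big_set1.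
have eP x y : x != y -> entry [set x; y] (Phi a) = a x + a y.
  move=> xy; have [p pE] := pset_ex xy.
  by rewrite -pE entry_pset ffunE pE big_setU1 ?inE //= big_set1.
by rewrite !eP //; field.
Qed.

Lemma gromov_split_vec S I : S \in pairs_off k ->
  gromov S (split_vec I) = (if k \in I then S \subset ~: I else S \subset I)%:R.
Proof.
case/pairs_offP => i [j [ij ki kj ->]]; rewrite /gromov big_setU1 ?inE //= big_set1.
rewrite !entry_split_vec // !subUset !sub1set !inE.
by case: (k \in I); case: (i \in I); case: (j \in I) => /=; field.
Qed.

Lemma gromov_rep v :
  v - \sum_(S in pairs_off k) gromov S v *: split_vec S \in @imPhi R n.
Proof.
(* For a pair {i, j} the sum has the entry A i + A j minus twice the coordinate at {i, j}. Inserting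
   the definition of this coordinate leaves the entries at {k, i} and {k, j} less A i and A j,
   whence the witness. *)
pose A i := \sum_(S in pairs_off k | i \in S) gromov S v.
apply/asboolP; exists (fun i => entry [set k; i] v - A i).
apply/ffunP => p; rewrite !ffunE sum_ffunE; set i := (val p).1; set j := (val p).2.
have ij : i != j := pair_neq p; have pE : pset p = [set i; j] by [].
have SE S : S \in pairs_off k -> (S == pset p) = (i \in S) && (j \in S).
  rewrite inE pE => /andP [/eqP S2 _]; rewrite eq_sym eqEcard S2 cards2 ij leqnn andbT.
  by rewrite subUset !sub1set.
have key S : S \in pairs_off k -> (gromov S v *: split_vec S) p =
    (if i \in S then gromov S v else 0) + (if j \in S then gromov S v else 0)
    - (if S == pset p then gromov S v *+ 2 else 0).
  move=> SP; rewrite !ffunE /= SE // pE pairI_eq1 // /GRing.scale /=.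
  by case: (i \in S); case: (j \in S) => /=; ring.
rewrite (eq_bigr _ key) sumrB big_split /= -!big_mkcondr /= -/(A i) -/(A j).
have Ak : A k = 0.
  by rewrite /A big_pred0 // => S; rewrite inE -andbA andNb andbF.
have eC x y : entry [set x; y] v = entry [set y; x] v by rewrite setUC.
rewrite big_setU1 ?inE //= big_set1 -[(sval p).1]/i -[(sval p).2]/j.
case pP: (pset p \in pairs_off k).
  rewrite (big_pred1 (pset p)); last first.
    by move=> S /=; case: eqP => [->|]; rewrite ?pP ?andbF.
  by rewrite /gromov entry_pset pE big_setU1 ?inE //= big_set1; field.
rewrite big_pred0; last by move=> S; case: eqP => [->|]; rewrite ?pP ?andbF.
rewrite -(entry_pset p v) pE subr0.
have : (k == i) || (k == j).
  by move: pP; rewrite inE card_pset /= pE !inE => /negbFE.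
case/orP => /eqP kE; rewrite -kE Ak setUid entry1; first by ring.
by rewrite (eC i); ring.
Qed.

Lemma piQ_sum (I : finType) (Q : pred I) (F : I -> Vn R n) :
  piQ (\sum_(i | Q i) F i) = \sum_(i | Q i) piQ (F i).
Proof. by apply: (big_morph (@piQ R n) (@piQD R n) piQ0). Qed.

Lemma piQ_rep v : piQ v = \sum_(S in pairs_off k) gromov S v *: vI R S.
Proof.
have /piQ_eq -> := gromov_rep v; rewrite piQ_sum.
by apply: eq_bigr => S _; rewrite piQZ.
Qed.

(** The image under [Phi] of the k-th unit vector has all coordinates 1 and is 0 in Q_n. By this
    relation a common constant may be subtracted from all coordinates. *)
Lemma sum_vI : \sum_(S in pairs_off k) vI R S = 0.
Proof.
pose v := Phi (fun i => (i == k)%:R) : Vn R n.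
have v0 : piQ v = 0.
  by rewrite -[RHS]piQ0; apply/piQ_eq; rewrite subr0; apply/asboolP; eexists.
rewrite -[RHS]v0 piQ_rep; apply: eq_bigr => S SP.
by rewrite gromov_Phi // eqxx scale1r.
Qed.

(** Subtracting the smallest coordinate gives an admissible representation. The coefficients of any
    other one differ from the coordinates by a constant, which is the minimum since they are
    nonnegative and one of them vanishes. *)
Lemma f_piQ v S0 : S0 \in pairs_off k ->
  (forall S, S \in pairs_off k -> gromov S0 v <= gromov S v) ->
  f_ k (piQ v) = \sum_(S in pairs_off k) (gromov S v - gromov S0 v).
Proof.
move=> S0P S0min; rewrite /f_; apply: xget_unique.
  exists (fun S => gromov S v - gromov S0 v); split=> //.
  - by move=> S SP; rewrite subr_ge0 S0min.
  - by exists S0; rewrite ?subrr.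
  under eq_bigr do rewrite scalerBl.
  by rewrite sumrB -scaler_sumr sum_vI scaler0 subr0 -piQ_rep.
move=> c [lam [lam0 [S1 S1P lamS1] vE ->]].
have : v - \sum_(S in pairs_off k) lam S *: split_vec S \in @imPhi R n.
  by apply/piQ_eq; rewrite vE piQ_sum; apply: eq_bigr => S _; rewrite piQZ.
case/asboolP => a aE.
have lamE S : S \in pairs_off k -> lam S = gromov S v - a k.
  move=> SP; have := congr1 (gromov S) aE; rewrite gromov_Phi // => <-.
  rewrite linearB /= linear_sum /= (bigD1 S) //= big1 ?addr0; last first.
    move=> S' /andP [S'P nS]; rewrite linearZ /= gromov_split_vec //.
    move: SP S'P; rewrite !inE => /andP [/eqP c2 _] /andP [/eqP c2' /negPf ->].
    case SS: (S \subset S'); last by rewrite mulr0.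
    by case/eqP: nS; apply/eqP; rewrite eq_sym eqEcard SS c2 c2'.
  rewrite linearZ /= gromov_split_vec // subxx; move: SP; rewrite inE => /andP [_ /negPf ->].
  by rewrite mulr1; ring.
have ak : a k = gromov S0 v.
  apply/eqP; rewrite eq_le; apply/andP; split.
    by rewrite -subr_ge0 -lamE // lam0.
  move: (S0min S1 S1P); have := lamE S1 S1P.
  by rewrite lamS1 => /eqP; rewrite eq_sym subr_eq0 => /eqP ->.
by apply: eq_bigr => S SP; rewrite lamE // ak.
Qed.

Lemma linear_descent (l : {linear Vn R n -> R^o}) : (forall a, l (Phi a) = 0) ->
  exists l' : {linear Qn R n -> R^o}, forall v, l' (piQ v) = l v.
Proof.
move=> l0.
pose g (q : Qn R n) : R^o := l (repr (q : Quotient.quot (@imPhi R n))).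
have gE v : g (piQ v) = l v.
  apply/eqP; rewrite -subr_eq0 /g -linearB; apply/eqP.
  have /piQ_eq/asboolP [a ->] := piQ_repr (piQ v); exact: l0.
have gL : linear g.
  move=> c x y; rewrite -[x]piQ_repr -[y]piQ_repr -piQZ -piQD !gE.
  by rewrite linearP.
pose G := GRing.isLinear.Build R (Qn R n) R^o _ g gL.
pose l' : {linear Qn R n -> R^o} := HB.pack g G.
by exists l'.
Qed.

Definition in_span (s : {set {set 'I_n}}) (q : Qn R n) :=
  exists c : {set 'I_n} -> R, q = \sum_(I in s) c I *: vI R I.

Lemma in_span0 s : in_span s 0.
Proof. by exists (fun=> 0); rewrite big1 // => I _; rewrite scale0r. Qed.

Lemma in_spanD s q q' : in_span s q -> in_span s q' -> in_span s (q + q').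
Proof.
case=> c -> [c' ->]; exists (fun I => c I + c' I); rewrite -big_split /=.
by apply: eq_bigr => I _; rewrite scalerDl.
Qed.

Lemma in_spanZ s a q : in_span s q -> in_span s (a *: q).
Proof.
case=> c ->; exists (fun I => a * c I); rewrite scaler_sumr.
by apply: eq_bigr => I _; rewrite scalerA.
Qed.

Lemma in_span_vI s I : I \in s -> in_span s (vI R I).
Proof.
move=> sI; exists (fun J => (J == I)%:R); rewrite (bigD1 I) //= eqxx scale1r big1 ?addr0 //.
by move=> J /andP [_ /negPf ->]; rewrite scale0r.
Qed.

(* On the cone s the coordinate at S0 is the smallest one, so f_k is given there
   by normalising this coordinate to 0. *)
Definition normalizing (s : {set {set 'I_n}}) S0 :=
  S0 \in pairs_off k /\ forall I, I \in s -> gromov S0 (split_vec I) = 0.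

Lemma gromov_ge0 S I : S \in pairs_off k -> 0 <= gromov S (split_vec I).
Proof. by move=> SP; rewrite gromov_split_vec // ler0n. Qed.

Lemma f_cone s S0 (lam : {set 'I_n} -> R) : normalizing s S0 -> (forall I, 0 <= lam I) ->
  f_ k (\sum_(I in s) lam I *: vI R I) =
  \sum_(I in s) lam I * \sum_(S in pairs_off k) gromov S (split_vec I).
Proof.
move=> [S0P S0s] lam0; pose v := \sum_(I in s) lam I *: split_vec I.
have gE S : gromov S v = \sum_(I in s) lam I * gromov S (split_vec I).
  by rewrite linear_sum; apply: eq_bigr => I _; rewrite linearZ.
have g0 : gromov S0 v = 0 by rewrite gE big1 // => I sI; rewrite S0s ?mulr0.
have -> : \sum_(I in s) lam I *: vI R I = piQ v.
  by rewrite piQ_sum; apply: eq_bigr => I _; rewrite piQZ.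
rewrite (f_piQ S0P) => [|S SP]; last first.
  by rewrite g0 gE sumr_ge0 // => I _; rewrite mulr_ge0 ?gromov_ge0.
under eq_bigr do rewrite g0 subr0 gE.
by rewrite exchange_big /=; apply: eq_bigr => I _; rewrite mulr_sumr.
Qed.

(** The right-hand side is linear in v and descends to a linear function on Q_n that agrees with f_k
    on the cone. Any other such function takes the same values at the rays, hence on their span. *)
Lemma lin_on_f (s : cone n) S0 v : normalizing (rays s) S0 -> in_span (rays s) (piQ v) ->
  lin_on (f_ k) s (piQ v) = \sum_(S in pairs_off k) (gromov S v - gromov S0 v).
Proof.
move=> nS0 [c vE]; have [S0P S0s] := nS0.
(* On [imPhi] all coordinates are equal, so subtracting the one at S0 makes L vanish there. *)
pose L v : R^o := \sum_(S in pairs_off k) (gromov S v - gromov S0 v).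
have LL : linear L.
  move=> a x y; rewrite /L scaler_sumr -big_split /=; apply: eq_bigr => S _.
  by rewrite !gromov_is_linear /GRing.scale /=; ring.
pose L' : {linear Vn R n -> R^o} := HB.pack L (GRing.isLinear.Build R (Vn R n) R^o _ L LL).
have L0 a : L' (Phi a) = 0.
  by rewrite /= /L big1 // => S SP; rewrite !gromov_Phi // subrr.
have [l lE] := linear_descent L0.
have lv I : I \in rays s -> l (vI R I) = \sum_(S in pairs_off k) gromov S (split_vec I).
  move=> sI; rewrite vI_split_vec lE /= /L.
  by apply: eq_bigr => S _; rewrite S0s // subr0.
rewrite /lin_on; apply: xget_unique.
  exists l; split; last by rewrite lE.
  move=> x [lam [lam0 ->]]; rewrite (f_cone nS0) // linear_sum.
  by apply: eq_bigr => I sI; rewrite linearZ lv.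
move=> _ [m [mE ->]]; rewrite -[RHS]/(L' v) -lE vE !linear_sum.
apply: eq_bigr => I sI; rewrite !linearZ lv // mE; last first.
  exists (fun J => (J == I)%:R); split; first by move=> J; rewrite ler0n.
  by rewrite (bigD1 I) //= eqxx scale1r big1 ?addr0 // => J /andP [_ /negPf ->]; rewrite scale0r.
congr (_ _ _); have := f_cone (lam := fun J => (J == I)%:R) nS0 (fun J => ler0n _ _).
have -> : \sum_(J in rays s) (J == I)%:R *: vI R J = vI R I.
  rewrite (bigD1 I) //= eqxx scale1r big1 ?addr0 // => J /andP [_ /negPf ->].
  by rewrite scale0r.
move=> ->; rewrite (bigD1 I) //= eqxx mul1r [X in _ + X]big1 ?addr0 // => J /andP [_ /negPf ->].
by rewrite mul0r.
Qed.

Lemma card_pairs_off : #|pairs_off k| = 'C(n.-1, 2).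
Proof.
have -> : pairs_off k = [set S : {set 'I_n} | S \subset ~: [set k] & #|S| == 2%N].
  apply/setP => S; rewrite !inE andbC; congr (_ && _).
  by rewrite -disjoints_subset disjoint_sym disjoints1.
by rewrite cards_draws cardsC1 card_ord.
Qed.

End Functional.
End Coordinates.

(** * Intersecting with a Psi-class *)

Section Facets.
Local Open Scope nat_scope.
Variables (n : nat).
Hypothesis n3 : 2 < n.
Implicit Types (I J B : {set 'I_n}) (s P Q A : {set {set 'I_n}}) (sigma tau : cone n).

Lemma rays_split_system sigma : split_system (rays sigma).
Proof. by rewrite -is_coneE //; exact: valP sigma. Qed.

Lemma leaf_star sigma i : exists2 P, star (rays sigma) P & [set i] \in P.
Proof.
have /asboolP [T sT] := valP sigma; rewrite /rays -sT.
exists (vstar (leaf T i)); first exact: vstar_star.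
by apply/vstarP; right; exists i.
Qed.

(** The halving in [cdim] is thus exact, and codimension one means exactly two more sets. *)
Lemma odd_split_system s : split_system s -> ~~ odd #|s|.
Proof.
move: {2}#|s| (leqnn #|s|) => m; elim: m s => [|m IH] s cs ss.
  by move: cs; rewrite leqn0 => /eqP ->.
have [->|/set0Pn [J sJ]] := eqVneq s set0; first by rewrite cards0.
have [ss0 nJ sE] := del_split ss sJ; set t := _ :\ _ in ss0 nJ sE.
have ct : #|s| = #|t|.+2 by rewrite sE card_add_split.
by rewrite ct /= negbK IH //; lia.
Qed.

Lemma codim1_faceP tau sigma J : codim1_face tau sigma ->
  J \in rays sigma :\: rays tau ->
  [/\ new_split (rays tau) J, rays sigma = add_split (rays tau) J
    & rays sigma :\: rays tau = [set J; ~: J]].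
Proof.
case/andP => sub /eqP cd; rewrite inE => /andP [nJ sJ].
have ss := rays_split_system sigma; have st := rays_split_system tau.
have [s1 s2 s3] := split_systemP _ ss; have [t1 t2 t3] := split_systemP _ st.
have c2 : #|rays sigma| = #|rays tau|.+2.
  have := odd_split_system ss; have := odd_split_system st.
  move: cd; rewrite /cdim.
  by move: #|rays sigma| #|rays tau| => a b; lia.
have nsJ : new_split (rays tau) J.
  rewrite /new_split nJ s2 // s2 ?s1 //=; apply/forall_inP => I /(subsetP sub) sI.
  exact: s3.
have sE : rays sigma = add_split (rays tau) J.
  apply/esym/eqP; rewrite eqEcard card_add_split // c2 leqnn andbT.
  by apply/subsetP => I; rewrite !inE => /or3P [/eqP ->|/eqP ->|/(subsetP sub)]; rewrite ?s1.
split=> //; have /and4P [nJC _ _ _] := new_splitC st nsJ.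
rewrite sE; apply/setP => I; rewrite !inE.
by case: eqP => [->|_]; case: eqP => [->|_]; rewrite ?nJ ?nJC //=; case: (I \in _).
Qed.

Lemma add_cone_proof tau J : new_split (rays tau) J -> is_cone (add_split (rays tau) J).
Proof. by move=> nJ; rewrite is_coneE // split_system_add // rays_split_system. Qed.

Lemma codim1_face_add tau J (nJ : new_split (rays tau) J) :
  codim1_face tau (exist _ (add_split (rays tau) J) (add_cone_proof nJ)).
Proof.
rewrite /codim1_face /cdim /rays /= card_add_split //; last exact: rays_split_system.
rewrite /= eqxx andbT; apply/subsetP => I; rewrite !inE => ->.
by rewrite !orbT.
Qed.

Lemma codim1_face_ex tau sigma : codim1_face tau sigma ->
  exists J, J \in rays sigma :\: rays tau.
Proof.
case/andP => sub /eqP cd; apply/set0Pn; rewrite setD_eq0; apply/negP => sub'.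
have := subset_leq_card sub'; move: cd; rewrite /cdim.
by move: #|rays sigma| #|rays tau| => a b; lia.
Qed.

(** The split picked in [prim]; the default [set0] has split vector 0, matching the default of
    [prim]. *)
Definition primset sigma tau := odflt set0 [pick J in rays sigma :\: rays tau].

(** A coface adds one pair J, ~: J to the splits of tau, hence the factor 2. Each of these sets is
    the cover of exactly one part A of exactly one star, by [new_split_ex] and [splits_star_inj]. *)
Lemma facet_sum (V : nmodType) (G : {set {set 'I_n}} -> {set 'I_n} -> V) tau :
  (forall s J, G s (~: J) = G s J) ->
  (\sum_(sigma | codim1_face tau sigma) G (rays sigma) (primset sigma tau) *+ 2 =
   \sum_(P in stars (rays tau)) \sum_(A : {set {set 'I_n}} | splits_star A P)
     G (add_split (rays tau) (cover A)) (cover A))%R.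
Proof.
move=> GC; have st := rays_split_system tau.
transitivity (\sum_(J | new_split (rays tau) J) G (add_split (rays tau) J) J)%R.
  transitivity (\sum_(sigma | codim1_face tau sigma)
      \sum_(J in rays sigma :\: rays tau) G (rays sigma) J)%R.
    apply: eq_bigr => sigma cs; have [J0 J0s] := codim1_face_ex cs.
    rewrite /primset; case: pickP => [J sJ|/(_ J0)]; last by rewrite J0s.
    have [nJ _ ->] := codim1_faceP cs sJ.
    rewrite big_setU1 ?big_set1 ?GC -?GRing.mulr2n // inE.
    have /and4P [_ J1 _ _] := nJ; have /card_gt0P [x xJ] := ltnW J1.
    by apply/eqP => /setP /(_ x); rewrite inE xJ.
  rewrite (exchange_big_dep (fun J => new_split (rays tau) J)) /=; last first.
    by move=> sigma J cs sJ; have [] := codim1_faceP cs sJ.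
  apply: eq_bigr => J nJ.
  pose sJ : cone n := exist _ (add_split (rays tau) J) (add_cone_proof nJ).
  rewrite (big_pred1 sJ) // => sigma /=; apply/andP/eqP => [[cs sJ']|->].
    by have [_ sE _] := codim1_faceP cs sJ'; apply: val_inj.
  split; first exact: codim1_face_add.
  by rewrite !inE eqxx andbT; have /and4P [] := nJ.
rewrite pair_big_dep /=.
rewrite (partition_big (fun p => cover p.2) (fun J => new_split (rays tau) J)) /=; last first.
  move=> [P A] /= /andP []; rewrite inE => sP aP; exact: new_split_star sP aP.
apply: eq_bigr => J nJ; have [P [A [sP aP cA]]] := new_split_ex st nJ.
rewrite (big_pred1 (P, A)) /= ?cA // => -[Q A'] /=; apply/andP/eqP => [[/andP []]|[-> ->]].
  rewrite inE => sQ aQ /eqP cA'.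
  by have [-> ->] := splits_star_inj sQ sP aQ aP (etrans cA' (esym cA)).
by rewrite inE sP aP cA eqxx.
Qed.

End Facets.

(** * The divisor of f_i at a cone *)

Section PsiMultiplication.
Variables (R : realType) (n : nat).
Hypothesis n3 : (2 < n)%N.
Implicit Types (I J B : {set 'I_n}) (s P Q A : {set {set 'I_n}}) (sigma tau : cone n).

(** S0 consists of labels a and b from two branches, other than the leaf i, at the vertex of i. No
    edge of the tree separates i from both of them; only the leaf i itself does. *)
Lemma normalizing_ex s (i : 'I_n) P : split_system s -> star s P -> [set i] \in P ->
  exists S0, normalizing R i s S0 /\ forall Q B, star s Q -> B \in Q ->
    gromov i S0 (split_vec R B) = (B == [set i])%:R.
Proof.
move=> ss sP iP; have /starP [pP cP bP _] := sP.
have /card_gt1P [C1 [C2 [C1P C2P nC]]] : (1 < #|P :\ [set i]|)%N.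
  by move: cP; rewrite (cardsD1 [set i]) iP add1n ltnS.
move: C1P C2P; rewrite !inE => /andP [C1i C1P] /andP [C2i C2P].
have /set0Pn [a aC1] := part_neq0 pP C1P; have /set0Pn [b bC2] := part_neq0 pP C2P.
have ab : a != b by apply: contraNneq nC => ab; apply/eqP/(part_eq pP C1P C2P aC1); rewrite ab.
have neqi x C : C \in P -> C != [set i] -> x \in C -> i != x.
  by move=> CP Ci xC; apply: contraNneq Ci => ix; apply/eqP/(part_eq pP CP iP xC); rewrite ix set11.
have SP : [set a; b] \in pairs_off i.
  by apply/pairs_offP; exists a, b; rewrite (neqi a C1) // (neqi b C2).
have nsub C : C \in P -> ~~ ([set a; b] \subset C).
  move=> CP; rewrite subUset !sub1set; apply/negP => /andP [aC bC].
  by case/eqP: nC; rewrite (part_eq pP C1P CP aC1 aC) (part_eq pP C2P CP bC2 bC).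
(* The complement of [set i] is left out because its coordinate at {a, b} is 1, like that of
   [set i]. *)
have key B : branch s B -> B != ~: [set i] ->
    gromov i [set a; b] (split_vec R B) = (B == [set i])%:R.
  move=> bB nB; rewrite gromov_split_vec //; congr ((nat_of_bool _)%:R); apply/esym.
  have [C CP /orP [BC|BC]] := star_branch sP bB; case iB: (i \in B).
  - have CE : C = [set i] by apply: (part_eq pP CP iP (subsetP BC i iB)); rewrite set11.
    have -> : B = [set i].
      by apply/eqP; rewrite eqEsubset sub1set iB andbT -CE.
    rewrite eqxx subUset !sub1set !inE -!(eq_sym i).
    by rewrite (negPf (neqi a C1 _ _ _)) // (negPf (neqi b C2 _ _ _)).
  - have /negPf -> : ~~ ([set a; b] \subset B)
      by apply: contra (nsub C CP) => /subset_trans; apply.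
        by apply: negbTE; apply/negP => /eqP Bi; rewrite Bi set11 in iB.
  - have /negPf -> : ~~ ([set a; b] \subset ~: B)
      by apply: contra (nsub C CP) => /subset_trans; apply.
    apply: negbTE; apply/negP => /eqP Bi; rewrite Bi in BC; exact: (part_subC pP cP iP CP BC).
  - case/eqP: nB; rewrite -[LHS]setCK; congr (~: _).
    have iC : i \in C by apply: (subsetP BC); rewrite inE iB.
    have CE : C = [set i] by apply: (part_eq pP CP iP iC); rewrite set11.
    by apply/eqP; rewrite eqEsubset -{1}CE BC sub1set inE iB.
exists [set a; b]; split.
  split=> // I sI; have [s1 s2 _] := split_systemP s ss.
  rewrite key ?/branch ?sI //.
    by case: eqP => // Ii; have := s2 I sI; rewrite Ii cards1.
  by apply/eqP => Ii; have := s2 _ (s1 I sI); rewrite Ii setCK cards1.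
move=> Q B sQ BQ; have /starP [pQ cQ bQ _] := sQ; apply: key; first exact: bQ.
have [B' B'Q iB'] := part_ex pQ i.
by apply/eqP => Bi; apply: (part_subC pQ cQ BQ B'Q); rewrite Bi setCK sub1set.
Qed.

Lemma split_vec0 : split_vec R (set0 : {set 'I_n}) = 0.
Proof. by apply/ffunP => p; rewrite !ffunE set0I cards0. Qed.

Lemma prim_primset sigma tau : prim R sigma tau = vI R (primset sigma tau).
Proof.
by rewrite /prim /primset; case: pickP => //= _; rewrite vI_split_vec split_vec0 piQ0.
Qed.

Lemma primset_in tau sigma : codim1_face tau sigma -> primset sigma tau \in rays sigma.
Proof.
case/(codim1_face_ex n3) => J0 J0s; rewrite /primset.
case: pickP => [J|/(_ J0)]; last by rewrite J0s.
by rewrite inE => /andP [].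
Qed.

(** A lift to the ambient space of the weighted sum of the primitive vectors at tau. *)
Definition facet_vec (Z : wfan R n) tau : Vn R n :=
  \sum_(sigma | codim1_face tau sigma) Z sigma *: split_vec R (primset sigma tau).

(** Each primitive vector is a ray of its facet, where the normalising coordinate is 0, so the
    facets contribute the sum of all coordinates of [facet_vec]. The term at tau is this sum with
    the coordinate at S0 subtracted from every summand. The difference is 'C(n-1, 2) times the
    coordinate at S0. *)
Lemma psi_mulE i (Z : wfan R n) tau S0 : normalizing R i (rays tau) S0 ->
  in_span (rays tau) (piQ (facet_vec Z tau)) ->
  psi_mul i Z tau = gromov i S0 (facet_vec Z tau).
Proof.
move=> nS0 bal; rewrite /psi_mul ffunE /divisor ffunE.
have dropZ (V : lmodType R) (F : cone n -> V) :
    \sum_(sigma | (Z sigma != 0) && codim1_face tau sigma) Z sigma *: F sigma =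
    \sum_(sigma | codim1_face tau sigma) Z sigma *: F sigma.
  rewrite [RHS](bigID (fun sigma => Z sigma != 0)) /= [X in _ = _ + X]big1 ?addr0.
    by apply: eq_bigl => sigma; rewrite andbC.
  by move=> sigma /andP [_ /negPn /eqP ->]; rewrite scale0r.
have facet sigma : codim1_face tau sigma ->
    lin_on (f_ i) sigma (Z sigma *: prim R sigma tau) =
    Z sigma * \sum_(S in pairs_off i) gromov i S (split_vec R (primset sigma tau)).
  move=> cs; have ss := rays_split_system n3 sigma.
  have [P sP iP] := leaf_star sigma i.
  have [S1 [nS1 _]] := normalizing_ex ss sP iP.
  have sv : in_span (rays sigma) (piQ (Z sigma *: split_vec R (primset sigma tau))).
    by rewrite piQZ; apply/in_spanZ/in_span_vI/primset_in.
  rewrite prim_primset vI_split_vec -piQZ (lin_on_f nS1 sv) mulr_sumr.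
  apply: eq_bigr => S _; rewrite !linearZ /= -mulrBr; congr (_ * _).
  by have [_ ->] := nS1; rewrite ?subr0 // primset_in.
rewrite (dropZ _ (fun sigma => prim R sigma tau)).
have -> : \sum_(sigma | codim1_face tau sigma) Z sigma *: prim R sigma tau =
    piQ (facet_vec Z tau).
  by rewrite piQ_sum; apply: eq_bigr => sigma _; rewrite piQZ prim_primset.
rewrite (lin_on_f nS0 bal).
have -> : \sum_(sigma | (Z sigma != 0) && codim1_face tau sigma)
     lin_on (f_ i) sigma (Z sigma *: prim R sigma tau) =
   \sum_(S in pairs_off i) gromov i S (facet_vec Z tau).
  transitivity (\sum_(sigma | (Z sigma != 0) && codim1_face tau sigma)
      Z sigma *: (\sum_(S in pairs_off i) gromov i S (split_vec R (primset sigma tau)) : R^o)).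
    by apply: eq_bigr => sigma /andP [_ cs]; rewrite facet.
  rewrite (dropZ R^o); under eq_bigr do rewrite scaler_sumr.
  rewrite exchange_big /=; apply: eq_bigr => S _.
  by rewrite [RHS]linear_sum; apply: eq_bigr => sigma _; rewrite [RHS]linearZ.
rewrite -sumrB; under eq_bigr do rewrite opprB addrC subrK.
rewrite sumr_const card_pairs_off -[gromov _ _ _ *+ _]mulr_natl mulKf //.
by rewrite pnatr_eq0 -lt0n bin_gt0; lia.
Qed.

Variable k : 'I_n -> nat.

(** Nonzero only if val = K + 4 at P and val = K + 3 at all other vertices. *)
Definition star_const s P : R :=
  (#|P| == stweight k P + 4)%:R * (\prod_(Q in stars s :\ P) starfact k Q)%:R.

Definition star_coef P B : R := (stweight k P).+1`!%:R / (bweight k B).+1%:R.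

(** Division by (w_B + 1)(w_C + 1) turns the factor w_B + w_C + 2 into the sum of the two
    reciprocals. *)
Lemma facetfact_separatingR s P B C : split_system s -> star s P ->
  B \in P -> C \in P -> B != C ->
  \sum_(A : {set {set 'I_n}} | [&& splits_star A P, B \in A & C \notin A])
     (facetfact k (add_split s (cover A)))%:R =
  star_const s P * (star_coef P B + star_coef P C) :> R.
Proof.
move=> ss sP BP CP BC; have := facetfact_separating k ss sP BP CP BC.
move/(congr1 (fun m : nat => m%:R : R)).
rewrite !natrM natr_sum /star_const /star_coef.
set S := \sum_(_ | _) _; set b := bweight k B; set c := bweight k C; move=> e.
have b0 : b.+1%:R != 0 :> R by rewrite pnatr_eq0.
have c0 : c.+1%:R != 0 :> R by rewrite pnatr_eq0.
have -> : S = S * (b.+1%:R * c.+1%:R) / (b.+1%:R * c.+1%:R) by rewrite mulfK // mulf_neq0.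
rewrite e; case: ifP => _; last by rewrite !mul0r.
rewrite natrM (_ : (b + c + 2 = b.+1 + c.+1)%N); last by lia.
rewrite natrD; move: b0 c0; move: (b.+1%:R : R) (c.+1%:R : R) => x y x0 y0.
rewrite /= mul1r; set F := _`!%:R; set N := (\prod_(_ in _) _)%:R; clearbody F N.
by field; rewrite x0 y0.
Qed.

(** The entries at a pair {i, j} are compared. They vanish if i and j lie in the same block.
    Otherwise the parts A containing only the block of i and those containing only the block of j
    each add up to the sum of the two coefficients, whence the factor 2. *)
Lemma star_facet_vec s P : split_system s -> star s P ->
  \sum_(A : {set {set 'I_n}} | splits_star A P)
    (facetfact k (add_split s (cover A)))%:R *: split_vec R (cover A) =
  (star_const s P *: \sum_(B in P) star_coef P B *: split_vec R B) *+ 2.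
Proof.
move=> ss sP; have /starP [pP _ _ _] := sP.
apply/ffunP => p; rewrite mulr2n !ffunE !sum_ffunE.
have ij := pair_neq p; set i := (val p).1 in ij; set j := (val p).2 in ij.
have vE B : split_vec R B p = ((i \in B) != (j \in B))%:R.
  by rewrite ffunE /pset pairI_eq1.
have [Bi BiP iB] := part_ex pP i; have [Bj BjP jB] := part_ex pP j.
have memP B x C : B \in P -> C \in P -> x \in C -> (x \in B) = (B == C).
  move=> BP CP xC; apply/idP/eqP => [xB|->//]; exact: (part_eq pP BP CP xB xC).
have memA A x C : A \subset P -> C \in P -> x \in C -> (x \in cover A) = (C \in A).
  move=> AP CP xC; apply/bigcupP/idP => [[B BA xB]|CA]; last by exists C.
  by rewrite (part_eq pP CP (subsetP AP B BA) xC xB).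
have LHS : \sum_(A : {set {set 'I_n}} | splits_star A P)
    ((facetfact k (add_split s (cover A)))%:R *: split_vec R (cover A)) p =
   \sum_(A : {set {set 'I_n}} | splits_star A P)
    (if (Bi \in A) != (Bj \in A) then (facetfact k (add_split s (cover A)))%:R else 0 : R).
  apply: eq_bigr => A /and3P [AP _ _]; rewrite ffunE vE.
  by rewrite (memA A i Bi) // (memA A j Bj) // /GRing.scale /=; case: eqP; rewrite ?mulr1 ?mulr0.
have RHS : \sum_(B in P) (star_coef P B *: split_vec R B) p =
    \sum_(B in P) (if (B == Bi) != (B == Bj) then star_coef P B else 0).
  apply: eq_bigr => B BP; rewrite ffunE vE.
  by rewrite (memP B i Bi) // (memP B j Bj) // /GRing.scale /=; case: eqP; rewrite ?mulr1 ?mulr0.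
rewrite LHS RHS /GRing.scale /=.
have [eB|nB] := eqVneq Bi Bj.
  by rewrite eB !big1 ?mulr0 ?addr0 // => *; rewrite eqxx.
have -> : \sum_(B in P) (if (B == Bi) != (B == Bj) then star_coef P B else 0) =
    star_coef P Bi + star_coef P Bj.
  rewrite (bigD1 Bi) //= (bigD1 Bj) /=; last by rewrite BjP eq_sym.
  rewrite !eqxx (negPf nB) [Bj == _]eq_sym (negPf nB) /= big1 ?addr0 // => B.
  by move=> /andP [/andP [_ /negPf ->] /negPf ->].
rewrite -[X in X + _](facetfact_separatingR ss sP BiP BjP nB).
rewrite [X in star_const _ _ * X]addrC.
rewrite -[X in _ + X](facetfact_separatingR ss sP BjP BiP); last by rewrite eq_sym.
rewrite -big_mkcondr (bigID (fun A => Bi \in A)) /=; congr (_ + _); apply: eq_bigl => A.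
  by rewrite -andbA; congr (_ && _); case: (Bi \in A); case: (Bj \in A).
by rewrite -andbA; congr (_ && _); case: (Bi \in A); case: (Bj \in A).
Qed.

End PsiMultiplication.

(** * The weights of products of Psi-classes *)

Section PsiWeights.
Variables (R : realType) (n : nat).
Hypothesis n3 : (2 < n)%N.
Implicit Types (k : 'I_n -> nat) (s P Q : {set {set 'I_n}}) (tau : cone n).

Definition psi_weight k : wfan R n :=
  [ffun sigma : cone n => (facetfact k (rays sigma))%:R / (\prod_i (k i)`!)%N%:R].

Lemma facet_vec_psi k tau : facet_vec (psi_weight k) tau =
  (\prod_i (k i)`!)%N%:R^-1 *: \sum_(P in stars (rays tau)) star_const R k (rays tau) P *:
     \sum_(B in P) star_coef R k P B *: split_vec R B.
Proof.
have st := rays_split_system n3 tau.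
pose G (s : {set {set 'I_n}}) (J : {set 'I_n}) := (facetfact k s)%:R *: split_vec R J.
have -> : facet_vec (psi_weight k) tau = (\prod_i (k i)`!)%N%:R^-1 *:
    \sum_(sigma | codim1_face tau sigma) G (rays sigma) (primset sigma tau).
  rewrite scaler_sumr; apply: eq_bigr => sigma _.
  by rewrite ffunE scalerA [_^-1 * _]mulrC.
congr (_ *: _).
(* Both [facet_sum] and [star_facet_vec] count every split twice, as J and as its complement. *)
have two : 2%:R != 0 :> R by rewrite pnatr_eq0.
apply: (scalerI two); rewrite !scaler_nat -sumrMnl.
rewrite (facet_sum n3); last by move=> s J; rewrite /G split_vecC.
rewrite -sumrMnl; apply: eq_bigr => P; rewrite inE => sP.
exact: star_facet_vec.
Qed.

Lemma in_span_sum (I : finType) (Q : pred I) s (F : I -> Qn R n) :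
  (forall i, Q i -> in_span s (F i)) -> in_span s (\sum_(i | Q i) F i).
Proof. by move=> h; apply: big_ind => //; [exact: in_span0|exact: in_spanD]. Qed.

Lemma balancing k tau : in_span (rays tau) (piQ (facet_vec (psi_weight k) tau)).
Proof.
rewrite facet_vec_psi piQZ piQ_sum; apply/in_spanZ/in_span_sum => P; rewrite inE => sP.
rewrite piQZ piQ_sum; apply/in_spanZ/in_span_sum => B BP; rewrite piQZ; apply: in_spanZ.
have /starP [_ _ bP _] := sP; case/orP: (bP B BP) => [|/cards1P [x ->]].
  exact: in_span_vI.
by rewrite -vI_split_vec vI1; apply: in_span0.
Qed.

Section Increment.
Variables (k k' : 'I_n -> nat) (i : 'I_n).
Hypothesis k'E : forall j, k' j = ((i == j) + k j)%N.

Lemma bweight_incr B : bweight k' B = ((B == [set i]) + bweight k B)%N.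
Proof.
have [->|nB] := eqVneq B [set i]; first by rewrite !bweight1 k'E eqxx.
rewrite /bweight; apply: eq_bigr => j /eqP Bj; rewrite k'E.
by case: eqP => // ij; rewrite Bj ij eqxx in nB.
Qed.

Lemma stweight_incr P : stweight k' P = (([set i] \in P) + stweight k P)%N.
Proof.
rewrite /stweight; under eq_bigr do rewrite bweight_incr.
rewrite big_split /=; congr (_ + _)%N; case iP: ([set i] \in P).
  by rewrite (big_setD1 _ iP) /= eqxx big1 // => B; rewrite !inE => /andP [/negPf ->].
by rewrite big1 // => B BP; case: eqP => // Bi; rewrite -Bi BP in iP.
Qed.

Lemma prod_fact_incr : (\prod_j (k' j)`! = (k i).+1 * \prod_j (k j)`!)%N.
Proof.
rewrite (bigD1 i) //= [in RHS](bigD1 i) //= k'E eqxx add1n factS -mulnA; congr (_ * (_ * _))%N.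
by apply: eq_bigr => j /negPf ji; rewrite k'E eq_sym ji.
Qed.

(** Only the block [set i] of the star at the leaf i contributes, with coefficient (K + 1)! / (k_i +
    1). As K + 1 is the new K at this star, the numerator is its new factor, and k_i + 1 is the
    factor by which the product of the k_j! grows. *)
Lemma psi_mul_weight : psi_mul i (psi_weight k) = psi_weight k'.
Proof.
apply/ffunP => tau; have st := rays_split_system n3 tau.
have [P0 sP0 iP0] := leaf_star tau i.
have [S0 [nS0 S0B]] := normalizing_ex R st sP0 iP0; have [S0P _] := nS0.
rewrite (psi_mulE n3 nS0 (balancing k tau)) facet_vec_psi linearZ /= linear_sum /=.
have P0s : P0 \in stars (rays tau) by rewrite inE.
have other Q : Q \in stars (rays tau) -> Q != P0 -> [set i] \notin Q.
  rewrite inE => sQ; apply: contraNN => iQ; apply/eqP; exact: (star_mem_inj sQ sP0 iQ iP0).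
have gE Q : Q \in stars (rays tau) ->
    gromov i S0 (star_const R k (rays tau) Q *: \sum_(B in Q) star_coef R k Q B *: split_vec R B) =
    star_const R k (rays tau) Q * \sum_(B in Q) star_coef R k Q B * (B == [set i])%:R.
  rewrite inE => sQ; rewrite [LHS]linearZ /= linear_sum /=; congr (_ * _).
  by apply: eq_bigr => B BQ; rewrite [LHS]linearZ /= (S0B Q).
rewrite (eq_bigr _ gE) (big_setD1 _ P0s) /= [X in _ + X]big1 ?addr0; last first.
  move=> Q; rewrite !inE => /andP [nQ sQ]; rewrite big1 ?mulr0 // => B BQ.
  have := other Q; rewrite inE => /(_ sQ nQ) iQ.
  by case: eqP => [Bi|_]; rewrite ?mulr0 // -Bi BQ in iQ *.
rewrite (big_setD1 _ iP0) /= eqxx mulr1 [X in _ + X]big1 ?addr0; last first.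
  by move=> B; rewrite !inE => /andP [/negPf -> _]; rewrite mulr0.
rewrite ffunE prod_fact_incr /facetfact (big_setD1 _ P0s) /=.
have -> : (\prod_(Q in stars (rays tau) :\ P0) starfact k' Q =
    \prod_(Q in stars (rays tau) :\ P0) starfact k Q)%N.
  apply: eq_bigr => Q; rewrite in_setD1 => /andP [nQ sQ].
  by rewrite /starfact stweight_incr (negPf (other Q sQ nQ)).
rewrite /star_const /star_coef /starfact stweight_incr iP0 bweight1.
rewrite (_ : (#|P0| == _ + _ + 3)%N = (#|P0| == stweight k P0 + 4)%N); last first.
  by rewrite add1n addSn -addnS.
case: eqP => _; last by rewrite /= !mul0r mulr0.
rewrite !natrM /= mul1r ?add1n.
set N := (\prod_(_ in _) _)%:R; set F := _`!%:R; set D := (\prod_j (k j)`!)%:R.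
rewrite invfM; set K := (k i).+1%:R; clearbody N F D K; ring.
Qed.

End Increment.

(** With all exponents 0 the weight is 1 if all vertices are 3-valent and 0 otherwise; by
    [stars_count] the former are the cones of dimension n - 3. *)
Lemma psi_weight0 : psi_weight (fun=> 0%N) = M0n R n.
Proof.
apply/ffunP => sigma; rewrite !ffunE big1 // divr1; congr (_%:R).
have ss := rays_split_system n3 sigma.
have k0 P : stweight (fun _ : 'I_n => 0%N) P = 0%N.
  by rewrite /stweight big1 // => B _; rewrite /bweight big1.
have [] := stars_count (fun=> 0%N) _ ss; first by rewrite card_ord.
rewrite card_ord -/(cdim sigma) => cE _.
have sf P : starfact (fun=> 0%N) P = (#|P| == 3) :> nat.
  by rewrite /starfact k0 add0n; case: eqP.
rewrite /facetfact; under eq_bigr do rewrite sf.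
case c: (cdim sigma == n - 3)%N.
  have : (\sum_(P in stars (rays sigma)) (#|P| - 3) == 0)%N.
    by move: cE; rewrite (eqP c); move: (\sum_(_ in _) _)%N => x; lia.
  rewrite sum_nat_eq0 => /forall_inP h; rewrite big1 // => P sP.
  have := h P sP; rewrite subn_eq0 => le3; move: sP; rewrite inE => /starP [_ c3 _ _].
  by have -> : #|P| == 3 by rewrite eqn_leq le3 c3.
have /forall_inPn [P sP c3] : ~~ [forall P in stars (rays sigma), #|P| - 3 == 0]%N.
  rewrite -sum_nat_eq0; move: cE c; move: (\sum_(_ in _) _)%N => x; lia.
rewrite (bigD1 P) //= (_ : (#|P| == 3) = false) //.
by apply: contraNF c3 => /eqP ->.
Qed.

Lemma psi_prod_weight (s : seq 'I_n) : psi_prod R s = psi_weight (fun i => count_mem i s).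
Proof.
elim: s => [|i s IH]; first by rewrite /psi_prod /= -psi_weight0.
by rewrite /psi_prod /= -/(psi_prod R s) IH; apply: psi_mul_weight.
Qed.

End PsiWeights.

(** * The weights in terms of the vertices of a tree *)

Section TreeWeights.
Local Open Scope nat_scope.
Variables (n : nat) (k : 'I_n -> nat) (T : ctype n).

Lemma stars_splits : stars (splits T) = [set vstar x | x : T].
Proof.
apply/setP => P; rewrite inE; apply/idP/imsetP => [/vstar_surj [x <-]|[x _ ->]].
  by exists x.
exact: vstar_star.
Qed.

Lemma stweight_vstar (x : T) : stweight k (vstar x) = Ksum k (Iset k x).
Proof.
transitivity (\sum_(i | leaf T i == x) k i).
  rewrite /stweight /vstar; set A := imset _ _; set B := imset _ _.
  rewrite (eq_bigl [predU A & B]) => [|C]; last by rewrite in_setU.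
  rewrite bigU /=; last first.
    apply/disjoint_memP => C /imsetP [y]; rewrite inE => xy -> /imsetP [i].
    rewrite inE => /eqP xi yi.
    by have := vside_leaf xy xi; rewrite yi set11.
  rewrite big1 => [|C /imsetP [y]].
    rewrite add0n big_imset /=; last by move=> i j _ _; apply: set1_inj.
    by apply: eq_big => [i|i _]; rewrite ?inE ?bweight1.
  rewrite inE => xy ->; apply: bweight_gt1.
  have [_ s2 _] := split_systemP _ (splits_split_system T).
  by apply: s2; apply/splitsP; exists y, x; rewrite adj_sym.
rewrite /Ksum /Iset (bigID (fun i => 1 <= k i)) /= [X in _ + X]big1 ?addn0.
  by apply: eq_bigl => i; rewrite inE.
by move=> i /andP [_]; case: (k i).
Qed.

Lemma facetfact_splits : facetfact k (splits T) =
  \prod_(x : T) if valence x == Ksum k (Iset k x) + 3 then (Ksum k (Iset k x))`! else 0.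
Proof.
rewrite /facetfact stars_splits big_imset /=; last by move=> x y _ _; apply: vstar_inj.
by apply: eq_bigr => x _; rewrite /starfact vstar_card stweight_vstar.
Qed.

(** Summing val - 3 = K(I_V) over the vertices gives K([n]), which [stars_count] turns into the
    dimension. *)
Lemma psi_typeE : 2 < n ->
  psi_type k T <-> forall x : T, valence x = Ksum k (Iset k x) + 3.
Proof.
move=> n3; split=> [[] //|h]; split=> //.
have [] := stars_count k _ (splits_split_system T); first by rewrite card_ord.
have -> : \sum_(P in stars (splits T)) (#|P| - 3) = \sum_(P in stars (splits T)) stweight k P.
  apply: eq_bigr => P; rewrite stars_splits => /imsetP [x _ ->].
  by rewrite vstar_card stweight_vstar h addnK.
move=> + e; rewrite e card_ord addnC => <-; congr (_ + _).
by apply: eq_bigl => i; rewrite inE.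
Qed.

End TreeWeights.

(** * The embedding *)

Section Distances.
Variables (R : realType) (n : nat) (C : curve R n).
Implicit Types x y z a b u : C.

Lemma tree_pathP x y : let p := tree_path x y in
  [/\ path (@adj n C) x p, last x p = y & uniq (x :: p)].
Proof.
have /connectP [p0 pp0 yl] := adj_connected x y.
case: (shortenP pp0) yl => p pp up _ yl.
pose good p := path (@adj n C) x p /\ last x p = y /\ uniq (x :: p).
have : good (tree_path x y) by apply: (@xgetPex _ [::] good); exists p.
by case=> ? [].
Qed.

Lemma path_vside x y u (p : seq C) : u \in vside y x -> u != x -> x \notin p ->
  path (@adj n C) u p -> last u p \in vside y x.
Proof.
elim: p u => //= v p IH u uV ux; rewrite inE negb_or => /andP [xv xp] /andP [uv vp].
apply: IH => //; rewrite 1?eq_sym //.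
by apply: (vside_step uV uv); rewrite (negPf ux) (eq_sym v x) (negPf xv) andbF.
Qed.

(** A path without repetitions crosses exactly the edges separating its ends, each directed from x
    to z. Apart from the first edge (x, y), an edge separates x from z if and only if it separates y
    from z. *)
Lemma sum_path_len (p : seq C) x z :
  path (@adj n C) x p -> last x p = z -> uniq (x :: p) ->
  \sum_(l <- pairmap (@len R n C) x p) l =
  \sum_(e : C * C | [&& adj e.1 e.2, x \in vside e.1 e.2 & z \in vside e.2 e.1])
    len e.1 e.2.
Proof.
elim: p x => [|y p IH] x /=.
  move=> _ <- _; rewrite big_nil big_pred0 // => -[a b] /=.
  case ab: (adj a b) => //=; apply/negP => /andP [xa].
  by apply/negP; apply: vside_disj.
move=> /andP [xy yp] zl /and3P [xyp yNp up]; rewrite big_cons (IH y) //; last by apply/andP.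
have xNy : x != y by apply: contraNneq xyp => ->; rewrite inE eqxx.
have xNp : x \notin p by apply: contraNN xyp => xp; rewrite inE xp orbT.
have zy : z \in vside y x.
  by rewrite -zl; apply: path_vside => //; [exact: vside_self|rewrite eq_sym].
have yx : adj y x by rewrite adj_sym.
rewrite [RHS](bigD1 (x, y)) /=; last by rewrite xy vside_self zy.
congr (_ + _); apply: eq_bigl => -[a b] /=; case ab: (adj a b) => //=.
rewrite xpair_eqE; apply/idP/idP => [/andP [ya zb]|/andP [/andP [xa zb] nab]].
  have nab : ~~ ((a == x) && (b == y)).
    apply/negP => /andP [/eqP ax /eqP bY]; move: ya; rewrite ax bY.
    by apply/negP; apply: vside_notin.
  rewrite zb nab !andbT; apply: (vside_step ya yx); rewrite negb_or; apply/andP; split.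
    apply/negP => /andP [/eqP ya' /eqP xb]; move: zb; rewrite -ya' -xb.
    by apply/negP; apply: vside_disj.
  by rewrite andbC eq_sym [y == b]eq_sym.
rewrite zb andbT; apply: (vside_step xa xy); rewrite negb_or (eq_sym x a) (eq_sym y b) nab /=.
apply/negP => /andP [/eqP xb _]; move: xa; rewrite xb.
by apply/negP; apply: vside_notin.
Qed.

Lemma dist_sum i j : dist C i j =
  \sum_(e : C * C | [&& adj e.1 e.2, leaf C i \in vside e.1 e.2 & leaf C j \in vside e.2 e.1])
    len e.1 e.2.
Proof. by rewrite /dist; have [] := tree_pathP (leaf C i) (leaf C j); exact: sum_path_len. Qed.

(* Each edge occurs in both directions, whence the halves. *)
Lemma phi_n_sum : phi_n C =
  piQ (\sum_(e : C * C | adj e.1 e.2) (len e.1 e.2 / 2) *: split_vec R (side e.1 e.2)).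
Proof.
rewrite /phi_n; congr piQ; apply/ffunP => p; rewrite ffunE sum_ffunE dist_sum.
set i := (val p).1; set j := (val p).2.
(* [D] selects the directed edges leading from the side of i to the side of j, and [sw] reverses an
   edge; the two directions contribute equally. *)
pose D (e : C * C) := (leaf C i \in vside e.1 e.2) && (leaf C j \in vside e.2 e.1).
pose sw (e : C * C) := (e.2, e.1).
have swK : involutive sw by case.
have -> : \sum_(e : C * C | adj e.1 e.2) ((len e.1 e.2 / 2) *: split_vec R (side e.1 e.2)) p =
    \sum_(e : C * C | adj e.1 e.2) ((if D e then len e.1 e.2 / 2 else 0) +
      (if D (sw e) then len e.1 e.2 / 2 else 0)).
  apply: eq_bigr => -[a b] /= ab; rewrite !ffunE /pset pairI_eq1 ?pair_neq //.
  rewrite -/i -/j !side_vside /D /= !(vsideE _ ab) /GRing.scale /=.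
  by case: (_ \in _); case: (_ \in _) => /=; rewrite ?mulr1 ?mulr0 ?addr0 ?add0r.
rewrite big_split /= [X in _ + X](reindex_inj (inv_inj swK)) /=.
have -> : \sum_(e : C * C | adj e.2 e.1) (if D (sw (sw e)) then len e.2 e.1 / 2 else 0) =
    \sum_(e : C * C | adj e.1 e.2) (if D e then len e.1 e.2 / 2 else 0).
  apply: eq_big => [e|e ba]; first by rewrite adj_sym.
  by rewrite swK (len_sym ba).
rewrite -!big_mkcondr /= -mulr_suml.
rewrite -[LHS]/(\sum_(e : C * C | adj e.1 e.2 && D e) len e.1 e.2).
by field.
Qed.

Lemma phi_n_cone : cone_pts (cone_of C) (phi_n C).
Proof.
exists (fun I => \sum_(e : C * C | adj e.1 e.2 && (side e.1 e.2 == I)) len e.1 e.2 / 2).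
split.
  by move=> I; apply: sumr_ge0 => e /andP [/len_pos /ltW le0 _]; rewrite divr_ge0.
rewrite phi_n_sum piQ_sum.
rewrite (partition_big (fun e : C * C => side e.1 e.2) (fun I => I \in splits C)) /=; last first.
  by move=> e ab; apply/splitsP; exists e.1, e.2.
apply: eq_bigr => I _; rewrite scaler_suml; apply: eq_bigr => e /andP [_ /eqP <-].
by rewrite piQZ.
Qed.

End Distances.

(** * From split systems back to metric curves *)

Lemma unit_curve (R : realType) (n : nat) (T : ctype n) : exists C : curve R n, ctype_of C = T.
Proof. by exists (@Curve R n T (fun _ _ => 1) (fun _ _ _ => erefl) (fun _ _ _ => ltr01)). Qed.

Theorem theorem4p1 (R : realType) (n : nat) (hn : (3 <= n)%N)
    (k : 'I_n -> nat) (s : seq 'I_n) (hs : forall i : 'I_n, count_mem i s = k i) :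
  (forall sigma : cone n,
     psi_prod R s sigma != 0 <->
     exists C : curve R n, cone_of C = sigma /\ psi_type k C)
  /\
  (forall C : curve R n, psi_type k C ->
     cone_pts (cone_of C) (phi_n C) /\
     psi_prod R s (cone_of C) =
       (\prod_(V : C) (Ksum k (Iset k V))`!)%N%:R / (\prod_(i < n) (k i)`!)%N%:R).
Proof.
have prodE : psi_prod R s = psi_weight R k.
  by rewrite psi_prod_weight //; congr psi_weight; apply/funext => i; apply: hs.
have fact0 : (\prod_(i < n) (k i)`!)%N%:R != 0 :> R.
  by rewrite pnatr_eq0 -lt0n prodn_gt0 // => i; apply: fact_gt0.
split=> [sigma|C psiC]; last first.
  split; first exact: phi_n_cone.
  rewrite prodE ffunE [rays _]/(splits C) facetfact_splits.
  have /(psi_typeE k C hn) valC := psiC.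
  congr (_%:R / _); apply: eq_bigr => x _; by rewrite valC eqxx.
rewrite prodE ffunE mulf_eq0 invr_eq0 (negPf fact0) orbF pnatr_eq0; split.
  have /asboolP [T sT] := valP sigma; have [C CT] := unit_curve R T.
  rewrite /rays -sT facetfact_splits -lt0n => pos.
  exists C; split; first by apply: val_inj; rewrite /= CT.
  (* A nonzero product has no vanishing factor, so every vertex satisfies the valence condition. *)
  rewrite CT; apply/(psi_typeE k T hn) => x; apply/eqP; move: pos.
  by rewrite (bigD1 x) //= muln_gt0; case: eqP => //.
case=> C [<- /(psi_typeE k C hn) valC].
rewrite [rays _]/(splits C) facetfact_splits -lt0n prodn_gt0 // => x.
by rewrite valC eqxx fact_gt0.
Qed.
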